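(* Let $A, B \subset \mathbb{F}_q\setminus\{0\}$ with $2\le |B| \leq |A|$ and let $L$ be a set of lines in $\mathbb{F}_q^2$. Suppose that \[ |A \cap (cG + d)| \ll \max \big\{|G|^{1/2}, |A|^{31/191}|B|^{129/191}\big\} \] for all proper subfields $G$ of $\mathbb{F}_q$ and all elements $c, d \in \mathbb{F}_q$. Then \[ T(A, B) \ll |A|^{383/191}|B|^{571/191} + q^{-1/103}|A|^{207/103}|B|^{3} + |A|^{3}|B|, \] \[ I(A \times B, L) \ll \big(|A|^{383/573}|B|^{571/573} + q^{-1/309}|A|^{207/309}|B| + |A||B|^{1/3}\big)|L|^{2/3} + |L|, \] \[ L(A \times B) \gg \min \big\{|A|^{380/191}|B|^{4/191},\ q^{2/103}|A|^{204/103},\ |B|^{4} \big\}. \]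
   Context: $q$ is a power of a prime and $\mathbb{F}_q$ is the finite field with $q$ elements. For sets $A,B\subset\mathbb{F}_q$, $T(A,B)$ is the number of sextuples $(a_1,a_2,a_3,b_1,b_2,b_3)\in A^3\times B^3$ with $(a_2-a_1)(b_3-b_1)=(a_3-a_1)(b_2-b_1)$. For a finite set of points $P\subset\mathbb{F}_q^2$ and a set of lines $L$ in $\mathbb{F}_q^2$, $I(P,L)=|\{(p,l)\in P\times L: p\in l\}|$. For $P\subset\mathbb{F}_q^2$, $L(P)$ is the number of distinct lines determined by pairs of (distinct) points of $P$ (this is unrelated to the set of lines $L$). $cG+d=\{cg+d: g\in G\}$. $X\ll Y$ (equivalently $Y\gg X$) means $X\le CY$ for an absolute constant $C>0$; the hypothesis is assumed with some fixed absolute constant, uniformly in $G,c,d$, and the implied constants in the conclusions may depend on that constant only. *)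

(* Defs.v *)
From mathcomp Require Import all_boot all_order all_algebra.
From mathcomp Require Import reals exp.
Set Implicit Arguments.
Unset Strict Implicit.
Unset Printing Implicit Defensive.
Import Order.TTheory GRing.Theory Num.Theory.
Local Open Scope ring_scope.

(* Finite-field geometry over [F : finFieldType]: the field of order [q] is
   any [F] with [#|F| = q], and the affine plane is the type [F * F]. *)

(* In a field [0^-1 = 0], so closure under [x - y] and [x / y], together with
   [1 \in G], says exactly that [G] is a subfield. *)
Definition subfield_set (F : finFieldType) (G : {set F}) : Prop :=
  GRing.divring_closed G.

Definition proper_subfield (F : finFieldType) (G : {set F}) : Prop :=
  subfield_set G /\ G \proper [set: F].

(* The set c G + d; the value [c = 0] is allowed and gives a singleton. *)
Definition affine_image (F : finFieldType) (c d : F) (G : {set F}) : {set F} :=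
  [set c * g + d | g in G].

Definition T (F : finFieldType) (A B : {set F}) : nat :=
  #|[set t : (F * F * F) * (F * F * F) |
      let: ((a1, a2, a3), (b1, b2, b3)) := t in
      [&& a1 \in A, a2 \in A, a3 \in A, b1 \in B, b2 \in B, b3 \in B
        & (a2 - a1) * (b3 - b1) == (a3 - a1) * (b2 - b1)]]|.

(* A line is represented by its set of points, so that distinct elements of a
   [{set {set F * F}}] are distinct lines. *)
Definition is_line (F : finFieldType) (l : {set F * F}) : bool :=
  [exists a : F, exists b : F, exists c : F,
    ((a, b) != (0, 0)) && (l == [set p | a * p.1 + b * p.2 == c])].

Definition incidences (F : finFieldType) (P : {set F * F})
    (L : {set {set F * F}}) : nat :=
  #|[set pl : (F * F) * {set F * F} |
      [&& pl.1 \in P, pl.2 \in L & pl.1 \in pl.2]]|.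

Definition determined_lines (F : finFieldType) (P : {set F * F}) :
    {set {set F * F}} :=
  [set l | is_line l &&
    [exists p in P, exists r in P, [&& p != r, p \in l & r \in l]]].

(* Main.v *)
Require Import Defs.
From mathcomp Require Import all_boot all_order all_algebra.
From mathcomp Require Import reals exp.
From mathcomp Require Import ring lra zify.
Set Implicit Arguments.
Unset Strict Implicit.
Unset Printing Implicit Defensive.
Import Order.TTheory GRing.Theory Num.Theory.
Local Open Scope ring_scope.

(** Write [N = #|A|], [n = #|B|] and [q = #|F|].

    Two fixed second coordinates [b1] and [b3] turn the equation that defines
    [T] into [a2 - s * a3 = (1 - s) * a1], where the slope
    [s = (b2 - b1) / (b3 - b1)] takes fewer than [n] values. Apart from
    degenerate triples, [T A B] is thus at most [n ^ 2] times the largest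
    number of solutions in [A] for such a set of slopes ([T_le_slopes]), and
    the first estimate says that the density [alpha] of these solutions is at
    most a constant times [y + z], where [y ^ 191 = N / n ^ 2] and
    [z ^ 103 = N / q].

    Suppose that the density is [alpha]. By the Balog-Szemeredi-Gowers
    theorem, one good slope gives a large part [U] of [A] with small doubling.
    For a typical slope [s], a translate of [s * U] has a large part in [A],
    so many of these parts overlap, and the triangle inequality yields a set
    [C] of about [alpha ^ 3 * n] multipliers [c] with
    [#|U - c * U| <= Q * #|U|] and [Q] about [alpha ^ -15] ([many_dilates]).
    By the Plunnecke-Ruzsa inequality, [U] also grows little under the ratios
    [(c1 - c2) / (c3 - c4)], which form the set [ratios C], and under further
    short expressions in elements of [C].

    On the other hand, a set cannot be close to too many of its dilates
    ([close_dilates_in_subfield]). If [#|U - r * U| <= P * #|U|] for all [r]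
    in [W], where [2 * P <= #|U|], counting the solutions of [u1 - u2 = r * (u3 - u4)] bounds [#|W|]
    by [2 * P * #|U|]; if [W] lies in a subfield [G], then [#|U|] can be
    replaced with the largest intersection of [U] with a set [c * G + d].
    Now there are three cases.
    - If [ratios C] is not a field, then [1 + r] or [c * r], for some ratio [r]
      and some [c] in [C], is an element [x] outside it ([ratios_subfield]).
      The [#|C| ^ 2] elements [c + x * c'] are distinct and move [U] little,
      so [alpha ^ 156 * n ^ 2] is at most a constant times [N].
    - If [ratios C] is the whole field, then [alpha ^ 60 * q] is at most a
      constant times [N].
    - If [ratios C] is a proper subfield [G], then the intersections of [A]
      with sets [c * G + d] reach a constant times [alpha ^ 18 * n], and also
      [alpha ^ 60 * #|G|]. This contradicts the assumption on subfields.
    The powers 156, 60 and 18 are below the values 191, 103 and 31 that the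
    exponents of the theorem require ([slopes_bound]).

    The other two estimates follow from the first. Since two distinct points
    determine a line, the sum of the cubes of the numbers of points of
    [setX A B] on lines that contain at least two of them is at most
    [2 * T A B]. Hoelder's inequality then bounds the incidences from above,
    and, as every pair of distinct points lies on a determined line, bounds
    the number of determined lines from below. *)

(** * Sumsets and the Plunnecke inequality *)

Section Sumsets.
Variable V : finZmodType.
Implicit Types A B H U X Y Z : {set V}.

Definition sumset A B : {set V} := [set x + y | x in A, y in B].
Definition diffset A B : {set V} := [set x - y | x in A, y in B].

Lemma mem_sumset A B x y : x \in A -> y \in B -> x + y \in sumset A B.
Proof. by move=> Ax By; apply/imset2P; exists x y. Qed.

Lemma mem_diffset A B x y : x \in A -> y \in B -> x - y \in diffset A B.
Proof. by move=> Ax By; apply/imset2P; exists x y. Qed.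

Lemma sumsetA A B Z : sumset (sumset A B) Z = sumset A (sumset B Z).
Proof.
apply/setP=> z; apply/imset2P/imset2P => [[_ c /imset2P[a b Aa Bb ->] Zc ->]|].
  by exists a (b + c) => //; [exact: mem_sumset | rewrite addrA].
move=> [a _ Aa /imset2P[b c Bb Zc ->] ->].
by exists (a + b) c => //; [exact: mem_sumset | rewrite addrA].
Qed.

Lemma sumset0 A : sumset A [set 0] = A.
Proof.
apply/setP=> z; apply/imset2P/idP => [[x y Ax /set1P-> ->]|Az].
  by rewrite addr0.
by exists z 0; rewrite ?set11 ?addr0.
Qed.

Lemma sumset_set0 A : sumset A set0 = set0.
Proof. by apply/setP=> z; rewrite inE; apply/imset2P => -[x y _]; rewrite inE. Qed.

Lemma sumsetS A B X Y : A \subset X -> B \subset Y -> sumset A B \subset sumset X Y.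
Proof. exact: imset2S. Qed.

Lemma diffsetS A B X Y :
  A \subset X -> B \subset Y -> diffset A B \subset diffset X Y.
Proof. exact: imset2S. Qed.

Lemma sumset_opp A B : sumset [set - x | x in A] B = diffset B A.
Proof.
apply/setP=> z; apply/imset2P/imset2P => [[_ y /imsetP[x Ax ->] By ->]|].
  by exists y x => //; rewrite addrC.
move=> [x y Bx Ay ->]; exists (- y) x; [exact: imset_f | by [] | exact: addrC].
Qed.

Lemma card_sumset_translate A z : #|[set x + z | x in A]| = #|A|.
Proof. by rewrite card_imset //; apply: addIr. Qed.

Lemma card_diffsetC A B : #|diffset A B| = #|diffset B A|.
Proof.
rewrite -[LHS](card_imset _ (@oppr_inj V)); congr #|pred_of_set _|.
apply/setP => w; apply/imsetP/imset2P => [[_ /imset2P[x y Ax By ->] ->]|].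
  by exists y x; rewrite ?opprB.
move=> [y x By Ax ->]; by exists (x - y); rewrite ?opprB ?mem_diffset.
Qed.

(** The map [(x, w) |-> (y_w - x, x - z_w)], for a chosen representation
    [w = y_w - z_w], is injective on [X * (Y - Z)]. *)
Lemma ruzsa_triangle X Y Z :
  (#|X| * #|diffset Y Z| <= #|diffset Y X| * #|diffset X Z|)%N.
Proof.
pose rep w := odflt (0, 0) [pick p | [&& p.1 \in Y, p.2 \in Z & w == p.1 - p.2]].
have repP w : w \in diffset Y Z ->
    [/\ (rep w).1 \in Y, (rep w).2 \in Z & w = (rep w).1 - (rep w).2].
  rewrite /rep => /imset2P[y z Yy Zz ->].
  case: pickP => [p /and3P[? ? /eqP]|/(_ (y, z))] //=.
  by rewrite Yy Zz eqxx.
pose f (p : V * V) := ((rep p.2).1 - p.1, p.1 - (rep p.2).2).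
rewrite -!cardsX -(@card_in_imset _ _ f).
  apply/subset_leq_card/subsetP => _ /imsetP[[x w] /setXP[Xx /repP[? ? _]] ->].
  by rewrite inE /= !mem_diffset.
move=> [x w] [x' w'] /setXP[/= Xx /repP[_ _ e]] /setXP[/= _ /repP[_ _ e']].
rewrite /f /= => -[e1 e2].
have ew : w = w'.
  by rewrite e e' -[(rep w).1](subrK x) e1 -addrA e2 addrA subrK.
rewrite -ew in e1 *; congr pair.
by move: e1 => /addrI/oppr_inj.
Qed.

(** The triangle inequality for [- X]; stated with sums because Petridis'
    inequality bounds sums. *)
Lemma ruzsa_triangle_sum X Y Z :
  (#|X| * #|diffset Y Z| <= #|sumset X Y| * #|sumset X Z|)%N.
Proof.
have opp_card A : #|[set - x | x in A]| = #|A|.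
  by rewrite card_imset //; apply: oppr_inj.
have -> : sumset X Y = diffset Y [set - x | x in X].
  rewrite -sumset_opp; congr sumset.
  by rewrite -imset_comp (eq_imset _ (@opprK V)) imset_id.
have <- : #|diffset [set - x | x in X] Z| = #|sumset X Z|.
  rewrite -[RHS]opp_card; congr #|pred_of_set _|.
  apply/setP => z; apply/imset2P/imsetP => [[_ y /imsetP[x Xx ->] Zy ->]|].
    by exists (x + y); [exact: mem_sumset | rewrite opprD].
  move=> [_ /imset2P[x y Xx Zy ->] ->].
  by exists (- x) y; rewrite ?imset_f // opprD.
by rewrite -(opp_card X) ruzsa_triangle.
Qed.

(** Petridis' argument: adding one element [z] to [Z] creates at most
    [#|X + B| - #|Y + B|] new sums, where [Y] gathers the [x] with
    [x + B + z] already covered, and minimality of the ratio of [X]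
    applies to [Y]. *)
Lemma petridis X B :
  (forall Y, Y \subset X -> #|sumset X B| * #|Y| <= #|sumset Y B| * #|X|)%N ->
  forall Z, (#|sumset (sumset X B) Z| * #|X| <= #|sumset X B| * #|sumset X Z|)%N.
Proof.
move=> minX Z; have [m] := ubnP #|Z|; elim: m Z => // m IHm Z ltZm.
have [->|[z Zz]] := set_0Vmem Z.
  by rewrite !sumset_set0 !cards0 mul0n muln0.
set Z' := Z :\ z.
have ltZ'm : (#|Z'| < m)%N by move: ltZm; rewrite (cardsD1 z Z) Zz.
have {IHm}IH := IHm Z' ltZ'm.
have ZE : Z = Z' :|: [set z] by rewrite setUC setD1K.
have sumU A : sumset A Z = sumset A Z' :|: [set x + z | x in A].
  apply/setP => w; rewrite inE; apply/imset2P/orP => [[x y Ax]|].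
    rewrite ZE inE => /orP[Z'y|/set1P->] ->; first by left; apply: mem_sumset.
    by right; apply: imset_f.
  case=> [/imset2P[x y Ax Z'y ->]|/imsetP[x Ax ->]].
    by exists x y => //; rewrite ZE inE Z'y.
  by exists x z.
pose Y := [set x in X | [set x + b + z | b in B] \subset sumset (sumset X B) Z'].
(* [W] measures the overlap of [X + z] with [X + Z'], and it lies in [Y]. *)
pose W := [set x in X | x + z \in sumset X Z'].
have sYX : Y \subset X by apply/subsetP => x; rewrite inE => /andP[].
have sWX : W \subset X by apply/subsetP => x; rewrite inE => /andP[].
have sWY : W \subset Y.
  apply/subsetP => x; rewrite !inE => /andP[-> /imset2P[x' z' Xx' Z'z' e]] /=.
  apply/subsetP => _ /imsetP[b Bb ->].
  rewrite addrAC e addrAC; apply: mem_sumset => //; exact: mem_sumset.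
have leY := minX Y sYX.
have upper : (#|sumset (sumset X B) Z| <=
    #|sumset (sumset X B) Z'| + (#|sumset X B| - #|sumset Y B|))%N.
  have sYB : sumset Y B \subset sumset X B by apply: sumsetS.
  rewrite -cardsDS //.
  rewrite -[X in (_ + X)%N](card_sumset_translate _ z).
  apply: leq_trans (leq_card_setU _ _); apply: subset_leq_card.
  rewrite sumU; apply/subsetP => w; rewrite !inE => /orP[->//|].
  move=> /imsetP[v XBv ->].
  have [YBv|nYBv] := boolP (v \in sumset Y B).
    case/imset2P: YBv => x b; rewrite inE => /andP[_ /subsetP sx] Bb ->.
    by rewrite sx //; apply/imsetP; exists b.
  by apply/orP; right; apply/imsetP; exists v; rewrite ?inE ?nYBv.
have lower : (#|sumset X Z'| + (#|X| - #|W|) <= #|sumset X Z|)%N.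
  rewrite -cardsDS // -[X in (_ + X)%N](card_sumset_translate _ z).
  rewrite -leq_subRL ?subset_leq_card ?sumU ?subsetUl // -cardsDS ?subsetUl //.
  apply: subset_leq_card; apply/subsetP => _ /imsetP[x + ->].
  rewrite !inE => /andP[nW Xx]; rewrite Xx /= in nW.
  by rewrite nW /=; apply/orP; right; apply/imsetP; exists x.
have := subset_leq_card sWY; have := subset_leq_card sYX.
have := subset_leq_card (sumsetS sYX (subxx B)).
move: upper lower leY IH.
move: #|sumset (sumset X B) Z| #|sumset (sumset X B) Z'| #|sumset X B|
  #|sumset Y B| #|sumset X Z| #|sumset X Z'| #|X| #|Y| #|W| => a a' k k' s s' x y w.
move=> h1 h2 h3 h4 h5 h6 h7.
apply: (@leq_trans ((a' + (k - k')) * x)%N); first by rewrite leq_mul2r h1 orbT.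
apply: (@leq_trans (k * (s' + (x - w)))%N); last by rewrite leq_mul2l h2 orbT.
rewrite mulnDl mulnDr leq_add //.
rewrite mulnBl leq_subLR.
apply: leq_trans (leq_add h3 (leqnn _)).
by rewrite -mulnDr leq_mul2l; apply/orP; right; lia.
Qed.

Definition nsum m H : {set V} := iter m (sumset H) [set 0].

Lemma mem_nsumS m H x y : x \in H -> y \in nsum m H -> x + y \in nsum m.+1 H.
Proof. exact: mem_sumset. Qed.

Lemma mem_nsum1 H x : x \in H -> x \in nsum 1 H.
Proof. by move=> Hx; rewrite -[x]addr0; apply: mem_nsumS; rewrite ?inE. Qed.

(** Petridis' inequality, iterated from the subset of [A] of least expansion,
    followed by the triangle inequality, which removes that subset. *)
Lemma plunnecke_ruzsa (R : realFieldType) A H (K : R) m l :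
  A != set0 -> 0 <= K -> #|sumset A H|%:R <= K * #|A|%:R ->
  #|diffset (nsum m H) (nsum l H)|%:R <= K ^+ (m + l) * #|A|%:R :> R.
Proof.
move=> nzA K0 leK.
(* [X] has the least ratio [#|X + H| / #|X|] among the subsets of [A]. *)
have : exists X : {set V}, [&& X != set0, X \subset A &
    [forall Y : {set V}, ((Y \subset A) && (Y != set0)) ==>
       (#|sumset X H| * #|Y| <= #|sumset Y H| * #|X|)%N]].
  pose ratio (X : {set V}) : rat := #|sumset X H|%:R / #|X|%:R.
  have PA : (A \subset A) && (A != set0) by rewrite subxx.
  case: (@Order.TotalTheory.arg_minP _ _ _ A (fun X => (X \subset A) && (X != set0)) ratio PA).
  move=> X /andP[sXA nzX] minX; exists X; rewrite nzX sXA /=.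
  apply/forallP => Y; apply/implyP => PY; have := minX _ PY.
  case/andP: PY => _ nzY; rewrite /ratio.
  by rewrite ler_pdivrMr ?ltr0n ?card_gt0 // mulrAC ler_pdivlMr
     ?ltr0n ?card_gt0 // -!natrM ler_nat.
case=> X /and3P[nzX sXA /forallP minX].
have X0 : 0 < #|X|%:R :> R by rewrite ltr0n card_gt0.
have A0 : 0 < #|A|%:R :> R by rewrite ltr0n card_gt0.
have XA : #|X|%:R <= #|A|%:R :> R by rewrite ler_nat subset_leq_card.
have pet : forall Z, (#|sumset (sumset X H) Z| * #|X| <= #|sumset X H| * #|sumset X Z|)%N.
  apply: petridis => Y sYX; have [->|nzY] := eqVneq Y set0.
    by rewrite cards0 muln0.
  by have := minX Y; rewrite nzY (subset_trans sYX sXA).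
have leXH : #|sumset X H|%:R <= K * #|X|%:R :> R.
  have := minX A; rewrite subxx nzA /= -(ler_nat R) !natrM => h.
  rewrite -(ler_pM2r A0); apply: le_trans h _.
  by rewrite mulrAC ler_pM2r.
have step k : #|sumset X (nsum k H)|%:R <= K ^+ k * #|X|%:R :> R.
  elim: k => [|k IH]; first by rewrite /nsum /= sumset0 expr0 mul1r.
  rewrite /= -sumsetA -(ler_pM2r X0).
  have := pet (nsum k H); rewrite -(ler_nat R) !natrM => /le_trans; apply.
  rewrite exprS -!mulrA [#|X|%:R * _]mulrC mulrA.
  rewrite [leRHS](_ : _ = (K * #|X|%:R) * (K ^+ k * #|X|%:R)); last by ring.
  by apply: ler_pM.
rewrite -(ler_pM2l X0) -natrM.
apply: (@le_trans _ _ ((K ^+ m * #|X|%:R) * (K ^+ l * #|X|%:R))).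
  apply: le_trans (ler_pM _ _ (step m) (step l)); rewrite ?ler0n //.
  by rewrite -natrM ler_nat ruzsa_triangle_sum.
rewrite exprD (_ : _ * _ = #|X|%:R * (K ^+ m * K ^+ l * #|X|%:R)); last by ring.
by rewrite ler_pM2l // ler_wpM2l // mulr_ge0 ?exprn_ge0.
Qed.

End Sumsets.

(** * The Balog-Szemeredi-Gowers theorem *)

(** With [w = 1] this is the Cauchy-Schwarz inequality; with [w = f] it
    compares the square of the second moment of [f] with the product of the
    first and the third, which gives Hoelder's inequality for cubes. *)
Lemma weighted_cauchy_schwarz (R : realFieldType) (I : finType) (P : pred I)
    (w f : I -> R) : (forall i, P i -> 0 <= w i) ->
  (\sum_(i | P i) w i * f i) ^+ 2
    <= (\sum_(i | P i) w i) * (\sum_(i | P i) w i * f i ^+ 2).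
Proof.
move=> w0; rewrite -(@ler_pM2l _ 2%:R) ?ltr0n // expr2.
rewrite mulr_suml mulr_suml [X in _ <= 2%:R * X](eq_bigr
  (fun i => \sum_(j | P j) w i * (w j * f j ^+ 2))); last by move=> i _; rewrite mulr_sumr.
rewrite [X in _ <= X](_ : _ = \sum_(i | P i) \sum_(j | P j)
    w i * w j * (f i ^+ 2 + f j ^+ 2)); last first.
  rewrite mulr_natl mulr2n [X in X + _]exchange_big -big_split /=.
  apply: eq_bigr => i _; rewrite -big_split /=; apply: eq_bigr => j _.
  by ring.
rewrite mulr_sumr; apply: ler_sum => i Pi; rewrite !mulr_sumr; apply: ler_sum => j Pj.
rewrite -subr_ge0 (_ : _ - _ = w i * w j * (f i - f j) ^+ 2); last by ring.
by rewrite mulr_ge0 ?sqr_ge0 ?mulr_ge0 ?w0.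
Qed.

Lemma cauchy_schwarz_card (R : realFieldType) (I : finType) (S : {set I}) (f : I -> R) :
  (\sum_(i in S) f i) ^+ 2 <= #|S|%:R * \sum_(i in S) f i ^+ 2.
Proof.
have := @weighted_cauchy_schwarz R I (mem S) (fun=> 1) f (fun _ _ => ler01).
rewrite sumr_const (eq_bigr f) => [|i _]; last by rewrite mul1r.
by rewrite [X in _ <= _ * X](eq_bigr (fun i => f i ^+ 2)) // => i _; rewrite mul1r.
Qed.

Lemma cardIsum (I : finType) (S : {set I}) (P : pred I) :
  #|[set x in S | P x]| = (\sum_(x in S) P x)%N.
Proof.
rewrite -sum1_card big_mkcond [RHS]big_mkcond; apply: eq_bigr => x _.
by rewrite inE; case: (x \in S); case: (P x).
Qed.

Lemma sum_card_fibers_le (I J : finType) (D : {set J}) (Q : {set I}) (f : I -> J) :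
  (\sum_(d in D) #|[set q in Q | f q == d]| <= #|Q|)%N.
Proof.
under eq_bigr do rewrite cardIsum.
rewrite exchange_big /= -sum1_card; apply: leq_sum => q _.
rewrite -big_mkcondr /= sum1_card.
apply: leq_trans (_ : #|[set f q]| <= 1)%N; last by rewrite cards1.
apply/subset_leq_card/subsetP => d; rewrite !inE unfold_in /= => /andP[_ /eqP->].
by rewrite eqxx.
Qed.

Section BSG.
Variables (R : realFieldType) (V : finZmodType).
Variables (X Y Z : {set V}) (N delta : R).
Hypotheses (N0 : 0 < N) (delta0 : 0 < delta).
Hypotheses (XN : #|X|%:R <= N) (YN : #|Y|%:R <= N) (ZN : #|Z|%:R <= N).
Hypothesis dense :
  delta * N ^+ 2 <= \sum_(y in Y) #|[set x in X | x - y \in Z]|%:R.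

Let nb x := [set y in Y | x - y \in Z].
Let cod y y' := [set x in X | (x - y \in Z) && (x - y' \in Z)].
Let bad y y' := #|cod y y'|%:R < delta ^+ 2 * N / 16%:R.
Let bd x : R := \sum_(y in nb x) #|[set y' in nb x | bad y y']|%:R.

Let sum_nb : \sum_(x in X) #|nb x|%:R = \sum_(y in Y) #|[set x in X | x - y \in Z]|%:R :> R.
Proof.
rewrite -!natr_sum; congr _%:R.
rewrite (eq_bigr (fun x : V => \sum_(y in Y) (x - y \in Z)%R)%N); last first.
  by move=> x _; rewrite /nb cardIsum.
by rewrite exchange_big; apply: eq_bigr => y _; rewrite cardIsum.
Qed.

Let sum_bd : \sum_(x in X) bd x <= delta ^+ 2 * N ^+ 3 / 16%:R.
Proof.
have -> : \sum_(x in X) bd x =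
    \sum_(y in Y) \sum_(y' in Y | bad y y') #|cod y y'|%:R.
  rewrite /bd (eq_bigr (fun x => \sum_(y in Y) \sum_(y' in Y | bad y y')
      ((x - y \in Z) && (x - y' \in Z))%:R)).
    rewrite exchange_big; apply: eq_bigr => y _.
    rewrite exchange_big; apply: eq_bigr => y' _.
    by rewrite /cod cardIsum natr_sum.
  move=> x _; rewrite big_mkcond [RHS]big_mkcond; apply: eq_bigr => y _.
  rewrite inE; case: (y \in Y) => //=; case: (x - y \in Z) => /=; last by rewrite big1.
  rewrite cardIsum natr_sum big_mkcond [RHS]big_mkcond /=; apply: eq_bigr => y' _.
  by rewrite inE; case: (y' \in Y) => //=; case: (x - y' \in Z) => /=; case: (bad y y').
apply: (@le_trans _ _ (\sum_(y in Y) \sum_(y' in Y) (delta ^+ 2 * N / 16%:R))).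
  apply: ler_sum => y _; rewrite big_mkcondr; apply: ler_sum => y' _.
  case: ifP => [/ltW //|_]; rewrite divr_ge0 ?ler0n // mulr_ge0 ?sqr_ge0 //.
  exact: ltW.
rewrite !sumr_const -[X in X <= _]mulr_natl -[X in _ * X <= _]mulr_natl.
rewrite [leRHS](_ : _ = N * (N * (delta ^+ 2 * N / 16%:R))); last by ring.
have c0 : 0 <= delta ^+ 2 * N / 16%:R by rewrite divr_ge0 ?ler0n // mulr_ge0 ?sqr_ge0 // ltW.
apply: ler_pM => //; first by rewrite mulr_ge0.
by apply: ler_pM.
Qed.

(* Compare the first two moments of [#|nb x|] with the mean of [bd x]. *)
Let exists_pivot : exists2 x, x \in X &
  delta ^+ 2 * N ^+ 2 / 4%:R <= #|nb x|%:R ^+ 2 - 8%:R * bd x.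
Proof.
have [/existsP[x /andP[Xx h]]|/existsPn no] :=
  boolP [exists x, (x \in X) && (delta ^+ 2 * N ^+ 2 / 4%:R <= #|nb x|%:R ^+ 2 - 8%:R * bd x)].
  by exists x.
exfalso.
have lo : delta ^+ 2 * N ^+ 3 <= \sum_(x in X) #|nb x|%:R ^+ 2.
  rewrite -(ler_pM2l N0).
  apply: (@le_trans _ _ (#|X|%:R * \sum_(x in X) #|nb x|%:R ^+ 2)); last first.
    by rewrite ler_wpM2r // sumr_ge0 // => x _; rewrite sqr_ge0.
  apply: le_trans (cauchy_schwarz_card X (fun x => #|nb x|%:R)).
  rewrite sum_nb (_ : N * _ = (delta * N ^+ 2) ^+ 2); last by ring.
  by rewrite ler_sqr ?nnegrE // ?sumr_ge0 // mulr_ge0 ?exprn_ge0 // ltW.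
have hi : \sum_(x in X) #|nb x|%:R ^+ 2 <=
    \sum_(x in X) (delta ^+ 2 * N ^+ 2 / 4%:R + 8%:R * bd x).
  apply: ler_sum => x Xx; have := no x; rewrite Xx /= -ltNge => /ltW.
  by rewrite lerBlDr.
move: (le_trans lo hi); rewrite big_split /= sumr_const -mulr_sumr.
rewrite -[X in X + _]mulr_natr => h.
have c0 : 0 < delta ^+ 2 * N ^+ 3 by rewrite mulr_gt0 ?exprn_gt0.
have : delta ^+ 2 * N ^+ 2 / 4%:R * #|X|%:R <= delta ^+ 2 * N ^+ 2 / 4%:R * N.
  by rewrite ler_wpM2l // divr_ge0 ?ler0n // mulr_ge0 ?sqr_ge0.
move: sum_bd h c0; rewrite (exprSr N 2); lra.
Qed.

(** Dependent random choice in the graph [x - y \in Z]: in the neighbourhood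
    of a suitable [x], almost all pairs [(w, u)] have many common neighbours,
    hence almost all [w] link two given points [u] and [u'] of a large part
    [U]. Each such [w] yields many ways to write [u - u'] as
    [z1 - z2 + z3 - z4] with entries in [Z]. *)
Lemma balog_szemeredi_gowers : exists U : {set V}, [/\ U \subset Y,
  delta * N / 4%:R <= #|U|%:R & #|diffset U U|%:R * delta ^+ 5 <= 1024%:R * N].
Proof.
have [x Xx hx] := exists_pivot.
have bd0 : 0 <= bd x by rewrite sumr_ge0.
have nb_ge : delta * N / 2%:R <= #|nb x|%:R.
  rewrite -ler_sqr ?nnegrE ?divr_ge0 ?mulr_ge0 ?(ltW N0) ?(ltW delta0) //.
  have -> : (delta * N / 2%:R) ^+ 2 = delta ^+ 2 * N ^+ 2 / 4%:R by field.
  by lra.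
have nb0 : 0 < #|nb x|%:R :> R by apply: lt_le_trans nb_ge; rewrite divr_gt0 ?mulr_gt0.
have bd_le : bd x <= #|nb x|%:R ^+ 2 / 8%:R.
  have : 0 <= delta ^+ 2 * N ^+ 2 / 4%:R by rewrite divr_ge0 ?ler0n // mulr_ge0 ?sqr_ge0.
  by lra.
(* Discard the points of [nb x] that are bad with more than a quarter of it:
   any two of the others have at least half of [nb x] as common good partners. *)
pose few u := #|[set y' in nb x | bad u y']|%:R <= #|nb x|%:R / 4%:R :> R.
pose U := [set u in nb x | few u].
have sU : U \subset nb x by apply/subsetP => u; rewrite inE => /andP[].
have cU : #|nb x|%:R / 2%:R <= #|U|%:R :> R.
  have : #|nb x :\: U|%:R * (#|nb x|%:R / 4%:R) <= #|nb x|%:R ^+ 2 / 8%:R :> R.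
    apply: le_trans bd_le; rewrite /bd (bigID (mem U)) /= addrC.
    apply: ler_wpDr; first by rewrite sumr_ge0.
    rewrite mulr_natl -sumr_const.
    rewrite (eq_bigl (fun i => (i \in nb x) && (i \notin U))); last first.
      by move=> i; rewrite inE andbC.
    apply: ler_sum => u /andP[nbu]; rewrite inE nbu /= /few -ltNge.
    exact: ltW.
  have -> : #|U|%:R = #|nb x|%:R - #|nb x :\: U|%:R :> R.
    rewrite cardsD (setIidPr sU) natrB ?subset_leq_card //; by ring.
  rewrite expr2 -!mulrA [in X in X -> _]mulrCA ler_pM2l //; lra.
exists U; split.
- by apply: subset_trans sU _; apply/subsetP => y; rewrite inE => /andP[].
- by apply: le_trans cU; lra.
pose quads := setX (setX Z Z) (setX Z Z).
pose val4 (t : (V * V) * (V * V)) := (t.1.1 - t.1.2) + (t.2.1 - t.2.2).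
have fiber d : d \in diffset U U ->
    delta ^+ 5 * N ^+ 3 / 1024%:R <= #|[set t in quads | val4 t == d]|%:R.
  case/imset2P => u u' Uu Uu' ->.
  pose good := [set w in nb x | ~~ bad u w && ~~ bad u' w].
  have good_ge : #|nb x|%:R / 2%:R <= #|good|%:R :> R.
    move: Uu Uu'; rewrite !inE => /andP[_ fu] /andP[_ fu'].
    have : (#|nb x| <= #|good| + (#|[set y' in nb x | bad u y']|
         + #|[set y' in nb x | bad u' y']|))%N.
      rewrite -leq_subLR -cardsDS; last by apply/subsetP => w; rewrite inE => /andP[].
      apply: leq_trans (leq_card_setU _ _); apply/subset_leq_card/subsetP => w.
      by rewrite !inE; case: (w \in Y); case: (x - w \in Z); case: (bad u w); case: (bad u' w).
    rewrite -(ler_nat R) !natrD; move: fu fu'; rewrite /few; lra.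
  pose Qd := [set t in quads | val4 t == u - u'].
  (* [g] recovers the middle point [w] from the representation
   [u - u' = (a - w) - (a - u) + ((b - u') - (b - w))]. *)
pose g (t : (V * V) * (V * V)) := u - (t.1.1 - t.1.2).
  have many w : w \in good ->
      (delta ^+ 2 * N / 16%:R) ^+ 2 <= #|[set t in Qd | g t == w]|%:R.
    rewrite inE => /andP[nbw /andP[]]; rewrite /bad -!leNgt => h h'.
    apply: (@le_trans _ _ (#|setX (cod u w) (cod u' w)|%:R)).
      rewrite cardsX natrM expr2.
      by apply: ler_pM => //; rewrite divr_ge0 // mulr_ge0 ?sqr_ge0 // ltW.
    pose f (p : V * V) := ((p.1 - w, p.1 - u), (p.2 - u', p.2 - w)).
    have finj : injective f by move=> [a b] [a' b'] [/addIr-> _ /addIr->].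
    rewrite ler_nat -(card_imset _ finj).
    apply/subset_leq_card/subsetP => _ /imsetP[[a b] /setXP[/= ha hb] ->].
    move: ha hb; rewrite !inE => /andP[_ /andP[Zau Zaw]] /andP[_ /andP[Zbu Zbw]].
    rewrite /f /val4 /g /= Zau Zaw Zbu Zbw /=.
    have cancel_mid (p q r : V) : (p - q) - (p - r) = r - q.
      by rewrite opprB addrC addrA subrK.
    by rewrite !cancel_mid addrA subrK eqxx subKr eqxx.
  apply: (@le_trans _ _ (\sum_(w in good) #|[set t in Qd | g t == w]|%:R)); last first.
    by rewrite -natr_sum ler_nat sum_card_fibers_le.
  apply: (@le_trans _ _ (\sum_(w in good) (delta ^+ 2 * N / 16%:R) ^+ 2)); last exact: ler_sum.
  rewrite sumr_const -[leRHS]mulr_natl.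
  rewrite [leLHS](_ : _ = (delta * N / 4%:R) * (delta ^+ 2 * N / 16%:R) ^+ 2); last by field.
  by rewrite ler_wpM2r ?sqr_ge0 //; lra.
have N30 : 0 < N ^+ 3 by rewrite exprn_gt0.
rewrite -(ler_pM2r N30) -(ler_pM2r (_ : 0 < 1024%:R^-1)); last by rewrite invr_gt0.
rewrite [leRHS](_ : _ = N * N * (N * N)); last by field.
apply: (@le_trans _ _ (#|quads|%:R)).
  apply: (@le_trans _ _ (\sum_(d in diffset U U) #|[set t in quads | val4 t == d]|%:R)); last first.
    by rewrite -natr_sum ler_nat sum_card_fibers_le.
  rewrite [leLHS](_ : _ = #|diffset U U|%:R * (delta ^+ 5 * N ^+ 3 / 1024%:R)); last by ring.
  rewrite mulr_natl -sumr_const.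
  exact: ler_sum.
rewrite !cardsX !natrM; apply: ler_pM; rewrite ?mulr_ge0 //; exact: ler_pM.
Qed.

End BSG.

(** * A set with small doubling close to many of its dilates *)

Section Dilates.
Variable F : finFieldType.
Implicit Types (A U X Y : {set F}) (c s z : F).

Definition dilate c A : {set F} := [set c * x | x in A].

Lemma mem_dilate c A x : x \in A -> c * x \in dilate c A.
Proof. exact: imset_f. Qed.

Lemma card_dilate c A : c != 0 -> #|dilate c A| = #|A|.
Proof. by move=> nzc; rewrite card_imset //; apply: mulfI. Qed.

Lemma dilate_dilate c s A : dilate c (dilate s A) = dilate (c * s) A.
Proof. by rewrite /dilate -imset_comp; apply: eq_imset => x /=; rewrite mulrA. Qed.

Lemma dilate1 A : dilate 1 A = A.
Proof. by rewrite /dilate (eq_imset _ (@mul1r F)) imset_id. Qed.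

Lemma dilate_diffset c A U : dilate c (diffset A U) = diffset (dilate c A) (dilate c U).
Proof.
apply/setP => w; apply/imsetP/imset2P => [[_ /imset2P[x y Ax Uy ->] ->]|].
  by exists (c * x) (c * y); rewrite ?mem_dilate ?mulrBr.
case=> _ _ /imsetP[x Ax ->] /imsetP[y Uy ->] ->.
by exists (x - y); rewrite ?mem_diffset ?mulrBr.
Qed.

Lemma card_diffset_dilate c A U : c != 0 ->
  #|diffset (dilate c A) (dilate c U)| = #|diffset A U|.
Proof. by move=> nzc; rewrite -dilate_diffset card_dilate. Qed.

Lemma card_diffset_translate A U z :
  #|diffset A [set x + z | x in U]| = #|diffset A U|.
Proof.
rewrite -(card_sumset_translate (diffset A [set x + z | x in U]) z); congr #|pred_of_set _|.
apply/setP => w; apply/imsetP/imset2P => [[_ /imset2P[x _ Ax /imsetP[y Uy ->] ->] ->]|].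
  by exists x y => //; rewrite opprD addrA subrK.
case=> x y Ax Uy ->; exists (x - (y + z)); last by rewrite opprD addrA subrK.
by apply: mem_diffset => //; apply/imsetP; exists y.
Qed.

End Dilates.

Section ManyDilates.
Variables (R : realFieldType) (F : finFieldType) (A S : {set F}) (n alpha : R).
Let N : R := #|A|%:R.
Let nbr s u := [set x in A | x - s * u \in dilate (1 - s) A].
Hypotheses (alpha0 : 0 < alpha) (n0 : 0 < n) (A0 : A != set0).
Hypotheses (S0 : 0 \notin S) (Sn : #|S|%:R <= n).
Hypothesis rich :
  alpha * N ^+ 2 * n <= \sum_(s in S) \sum_(u in A) #|nbr s u|%:R.

Let N0 : 0 < N. Proof. by rewrite ltr0n card_gt0. Qed.

Let deg u : R := \sum_(s in S) #|nbr s u|%:R.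
(* Any subset [U] of [A1] keeps, on average over [s] in [S], the density
   [alpha / 2] of the relation [x - s * u \in dilate (1 - s) A]. *)
Let A1 := [set u in A | alpha * N * n / 2%:R <= deg u].

Let rich_A1 : alpha * N ^+ 2 * n / 2%:R <= \sum_(s in S) \sum_(u in A1) #|nbr s u|%:R.
Proof.
have tot : alpha * N ^+ 2 * n <=
    \sum_(u in A1) deg u + \sum_(u in A | u \notin A1) deg u.
  apply: le_trans rich _; rewrite exchange_big /= (bigID (mem A1)) /= lerD2r.
  rewrite (eq_bigl (mem A1)) // => u; rewrite !inE; by case: (u \in A).
rewrite exchange_big /=.
have : \sum_(u in A | u \notin A1) deg u <= alpha * N ^+ 2 * n / 2%:R.
  apply: (@le_trans _ _ (\sum_(u in A) (alpha * N * n / 2%:R))).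
    rewrite big_mkcondr; apply: ler_sum => u Au; rewrite inE Au /= -ltNge.
    case: ifP => [/ltW //|_]; rewrite divr_ge0 ?ler0n // !mulr_ge0 ?ltW //.
  rewrite sumr_const -[leLHS]mulr_natl -/N le_eqVlt; apply/orP; left; apply/eqP; by field.
move: tot; rewrite /deg; lra.
Qed.

Let rich_dilate : exists2 s, s \in S &
  alpha / 2%:R * N ^+ 2 <= \sum_(u in A1) #|nbr s u|%:R.
Proof.
have [/existsP[s /andP[]]|/existsPn no] := boolP
  [exists s, (s \in S) && (alpha / 2%:R * N ^+ 2 <= \sum_(u in A1) #|nbr s u|%:R)].
  by exists s.
exfalso.
have pos : 0 < alpha * N ^+ 2 * n / 2%:R by rewrite !mulr_gt0 ?invr_gt0 ?exprn_gt0.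
have [S_0|[s0 Ss0]] := set_0Vmem S.
  by move: rich_A1; rewrite S_0 big_set0 leNgt pos.
have : \sum_(s in S) \sum_(u in A1) #|nbr s u|%:R < \sum_(s in S) (alpha / 2%:R * N ^+ 2).
  apply: ltr_sum; first by apply/hasP; exists s0; rewrite ?mem_index_enum.
  by move=> s Ss; have := no s; rewrite Ss /= -ltNge.
rewrite sumr_const -[ltRHS]mulr_natl => /(le_lt_trans rich_A1).
have : #|S|%:R * (alpha / 2%:R * N ^+ 2) <= n * (alpha / 2%:R * N ^+ 2).
  by rewrite ler_wpM2r // !mulr_ge0 ?invr_ge0 ?sqr_ge0 // ltW.
lra.
Qed.

Let small_doubling : exists U : {set F}, [/\ U \subset A1,
  alpha * N / 8%:R <= #|U|%:R & #|diffset U U|%:R * alpha ^+ 5 <= 2%:R ^+ 15 * N].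
Proof.
have [s Ss hs] := rich_dilate.
have nzs : s != 0 by apply: contraNneq S0 => <-.
have dense : alpha / 2%:R * N ^+ 2 <=
    \sum_(y in dilate s A1) #|[set x in A | x - y \in dilate (1 - s) A]|%:R.
  by rewrite big_imset //= => x y _ _; apply: mulfI.
have a20 : 0 < alpha / 2%:R by rewrite divr_gt0.
have [||U' [sU' U'N dU']] := @balog_szemeredi_gowers R F _ _ _ N _ N0 a20 (lexx _) _ _ dense.
- rewrite card_dilate // ler_nat; apply/subset_leq_card/subsetP => u.
  by rewrite inE => /andP[].
- by rewrite ler_nat; apply: leq_imset_card.
have defU' : U' = dilate s (dilate s^-1 U') by rewrite dilate_dilate mulfV // dilate1.
exists (dilate s^-1 U'); split.
- apply/subsetP => _ /imsetP[v /(subsetP sU') /imsetP[x A1x ->] ->].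
  by rewrite mulKf.
- by rewrite card_dilate ?invr_eq0 //; apply: le_trans U'N; lra.
rewrite card_diffset_dilate ?invr_eq0 //.
by move: dU'; rewrite expr_div_n; move: (alpha ^+ 5) => a5; lra.
Qed.

(* The differences [x - s * u] in [dilate (1 - s) A] take at most [N] values,
   and the most frequent one translates [dilate s U] onto a set that meets [A] often. *)
Let popular_translate (U : {set F}) s : s != 0 -> exists z,
  \sum_(u in U) #|nbr s u|%:R <= N * #|A :&: [set x + z | x in dilate s U]|%:R.
Proof.
move=> nzs.
pose V z := A :&: [set x + z | x in dilate s U].
have [/existsP[z hz]|/existsPn no] := boolP
  [exists z, \sum_(u in U) #|nbr s u|%:R <= N * #|V z|%:R]; first by exists z.
exfalso.
have Z0 : dilate (1 - s) A != set0.
  by case/set0Pn: A0 => x Ax; apply/set0Pn; exists ((1 - s) * x); apply: mem_dilate.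
have total : \sum_(u in U) #|nbr s u|%:R = \sum_(z in dilate (1 - s) A) #|V z|%:R :> R.
  rewrite (eq_bigr (fun u => \sum_(z in dilate (1 - s) A) (z + s * u \in A)%:R)).
    rewrite exchange_big; apply: eq_bigr => z _.
    rewrite -natr_sum -cardIsum; congr _%:R.
    rewrite -(@card_in_imset _ _ (fun u => s * u + z)); last first.
      by move=> x y _ _ /addIr/(mulfI nzs).
    congr #|pred_of_set _|; apply/setP => w; rewrite !inE.
    apply/imsetP/andP => [[u + ->]|[Aw /imsetP[_ /imsetP[u Uu ->] e]]].
      rewrite inE addrC => /andP[Uu ->]; split => //.
      by apply/imsetP; exists (s * u); rewrite ?mem_dilate // addrC.
    by exists u => //; rewrite inE Uu addrC -e Aw.
  move=> u _; rewrite -natr_sum -cardIsum; congr _%:R.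
  rewrite -[RHS](@card_in_imset _ _ (fun z => z + s * u)); last by move=> x y _ _ /addIr.
  congr #|pred_of_set _|; apply/setP => w; rewrite !inE.
  apply/andP/imsetP => [[Aw Zw]|[z + ->]].
    by exists (w - s * u); rewrite ?inE ?subrK ?Zw.
  by rewrite inE addrK => /andP[-> ->].
have [z0 Zz0] := set0Pn _ Z0.
have : \sum_(z in dilate (1 - s) A) (N * #|V z|%:R) <
       \sum_(z in dilate (1 - s) A) \sum_(u in U) #|nbr s u|%:R.
  apply: ltr_sum; first by apply/hasP; exists z0; rewrite ?mem_index_enum.
  by move=> z _; rewrite ltNge no.
rewrite -mulr_sumr -total sumr_const -[ltRHS]mulr_natl ltNge => /negP[].
rewrite ler_wpM2r ?sumr_ge0 // ler_nat; exact: leq_imset_card.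
Qed.

(** The set [U] comes from a single [s], but every typical [s] places a large
    part of a translate of [s * U] inside [A]. By Cauchy-Schwarz some [s0] has
    a piece that overlaps many others, and the triangle inequality through the
    overlap, together with the small doubling of [U], shows that [s * U] and
    [s0 * U] are close to each other. Then [C] gathers the ratios [s / s0]. *)
Lemma many_dilates : exists U C : {set F}, [/\ U \subset A,
  alpha * N / 8%:R <= #|U|%:R, alpha ^+ 3 * n / 64%:R <= #|C|%:R, (1 \in C) && (0 \notin C) &
  forall c, c \in C -> #|diffset U (dilate c U)|%:R * alpha ^+ 15 <= 2%:R ^+ 42 * #|U|%:R].
Proof.
have [U [sU UN dU]] := small_doubling.
have sUA : U \subset A.
  by apply: subset_trans sU _; apply/subsetP => u; rewrite inE => /andP[].
have nzS s : s \in S -> s != 0 by move=> Ss; apply: contraNneq S0 => <-.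
have U0 : 0 < #|U|%:R :> R by apply: lt_le_trans UN; rewrite !mulr_gt0 ?invr_gt0.
have [z hz] : exists z : F -> F, forall s, s != 0 ->
    \sum_(u in U) #|nbr s u|%:R <= N * #|A :&: [set x + z s | x in dilate s U]|%:R.
  apply: (@fin_all_exists _ _ (fun s zs => s != 0 ->
    \sum_(u in U) #|nbr s u|%:R <= N * #|A :&: [set x + zs | x in dilate s U]|%:R)) => s.
  have [->|nzs] := eqVneq s 0; first by exists 0.
  by have [zs h] := popular_translate U nzs; exists zs.
pose V s := A :&: [set x + z s | x in dilate s U].
have cV s : s != 0 -> #|V s|%:R <= #|U|%:R :> R.
  move=> nzs; rewrite ler_nat -(card_dilate U nzs) -(card_sumset_translate (dilate s U) (z s)).
  by rewrite subset_leq_card // subsetIr.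
have sumV : alpha * n * #|U|%:R / 2%:R <= \sum_(s in S) #|V s|%:R.
  rewrite -(ler_pM2l N0) mulr_sumr.
  apply: (@le_trans _ _ (\sum_(s in S) \sum_(u in U) #|nbr s u|%:R)); last first.
    by apply: ler_sum => s Ss; apply: hz; apply: nzS.
  rewrite exchange_big /=.
  apply: (@le_trans _ _ (\sum_(u in U) (alpha * N * n / 2%:R))).
    rewrite sumr_const -[leRHS]mulr_natl le_eqVlt; apply/orP; left; apply/eqP; by field.
  by apply: ler_sum => u /(subsetP sU); rewrite inE => /andP[].
have sumVV : (alpha * n * #|U|%:R / 2%:R) ^+ 2 / N <=
    \sum_(s in S) \sum_(s' in S) #|V s :&: V s'|%:R.
  pose mult x : R := \sum_(s in S) (x \in V s)%:R.
  have -> : \sum_(s in S) \sum_(s' in S) #|V s :&: V s'|%:R = \sum_(x in A) mult x ^+ 2.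
    under [RHS]eq_bigr do rewrite expr2 mulr_suml.
    rewrite [RHS]exchange_big; apply: eq_bigr => s _.
    under [RHS]eq_bigr do rewrite mulr_sumr.
    rewrite [RHS]exchange_big; apply: eq_bigr => s' _.
    rewrite -sum1_card natr_sum big_mkcond [RHS]big_mkcond.
    apply: eq_bigr => x _; rewrite !inE.
    case: (x \in A) => //=; case: (x \in _); case: (x \in _);
      by rewrite /= ?mul0r ?mulr0 ?mulr1.
  rewrite ler_pdivrMr // [leRHS]mulrC.
  apply: le_trans (cauchy_schwarz_card A mult).
  have -> : \sum_(x in A) mult x = \sum_(s in S) #|V s|%:R.
    rewrite exchange_big; apply: eq_bigr => s _.
    rewrite -sum1_card natr_sum big_mkcond [RHS]big_mkcond.
    by apply: eq_bigr => x _; rewrite !inE; case: (x \in A); case: (x \in _).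
  rewrite ler_sqr ?nnegrE ?sumr_ge0 // divr_ge0 ?ler0n // !mulr_ge0 ?ler0n // ltW //.
(* The bounds [sumVV] and [UN] make the mean of [#|V s0 :&: V s|] over [S] at
   least [2 * thr] for some [s0]. *)
pose thr := alpha ^+ 3 * #|U|%:R / 64%:R.
have thr0 : 0 < thr by rewrite !mulr_gt0 ?invr_gt0 ?exprn_gt0.
have [s0 Ss0 hs0] : exists2 s0, s0 \in S &
    2%:R * n * thr <= \sum_(s in S) #|V s0 :&: V s|%:R.
  have [/existsP[s /andP[]]|/existsPn no] := boolP [exists s, (s \in S) &&
    (2%:R * n * thr <= \sum_(s' in S) #|V s :&: V s'|%:R)]; first by exists s.
  exfalso.
  have big : n * (2%:R * n * thr) <= (alpha * n * #|U|%:R / 2%:R) ^+ 2 / N.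
    rewrite ler_pdivlMr //.
    rewrite [leRHS](_ : _ =
      alpha ^+ 2 * n ^+ 2 * #|U|%:R / 4%:R * #|U|%:R); last by field.
    apply: (@le_trans _ _ (alpha ^+ 2 * n ^+ 2 * #|U|%:R / 4%:R * (alpha * N / 8%:R))).
      by rewrite /thr le_eqVlt; apply/orP; left; apply/eqP; by field.
    by rewrite ler_wpM2l // divr_ge0 // mulr_ge0 // mulr_ge0 // sqr_ge0.
  have pos : 0 < n * (2%:R * n * thr) by rewrite (mulr_gt0 n0) // mulr_gt0 // mulr_gt0 ?ltr0n.
  have [S_0|[s1 Ss1]] := set_0Vmem S.
    by move: (le_trans big sumVV); rewrite S_0 big_set0 leNgt pos.
  have : \sum_(s in S) \sum_(s' in S) #|V s :&: V s'|%:R < \sum_(s in S) (2%:R * n * thr).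
    apply: ltr_sum; first by apply/hasP; exists s1; rewrite ?mem_index_enum.
    by move=> s Ss; have := no s; rewrite Ss /= -ltNge.
  move/(le_lt_trans (le_trans big sumVV)).
  rewrite sumr_const -[ltRHS]mulr_natl ltNge ler_wpM2r // mulr_ge0 ?(ltW thr0) //.
  by rewrite mulr_ge0 ?ler0n // ltW.
have nzs0 := nzS _ Ss0.
pose S2 := [set s in S | thr <= #|V s0 :&: V s|%:R].
have cS2 : alpha ^+ 3 * n / 64%:R <= #|S2|%:R.
  have : \sum_(s in S) #|V s0 :&: V s|%:R <= #|S2|%:R * #|U|%:R + n * thr.
    rewrite (bigID (mem S2)) /= lerD //.
      rewrite mulr_natl -sumr_const [leRHS]big_mkcond [leLHS]big_mkcond.
      apply: ler_sum => s _; rewrite inE; case: (s \in S) => //=.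
      case: ifP => // _; apply: le_trans (cV _ nzs0).
      by rewrite ler_nat subset_leq_card // subsetIl.
    apply: (@le_trans _ _ (\sum_(s in S) thr)).
      rewrite big_mkcondr; apply: ler_sum => s Ss; rewrite inE Ss /= -ltNge.
      by case: ifP => [/ltW //|_]; apply: ltW.
    by rewrite sumr_const -[leLHS]mulr_natl ler_wpM2r // ltW.
  move/(le_trans hs0) => h.
  rewrite -(ler_pM2r U0); move: h; rewrite /thr; lra.
have S2s0 : s0 \in S2.
  have : 0 < #|S2|%:R :> R by apply: lt_le_trans cS2; rewrite !mulr_gt0 ?invr_gt0 ?exprn_gt0.
  rewrite ltr0n card_gt0 => /set0Pn[s]; rewrite !inE => /andP[_ h].
  by rewrite Ss0 (le_trans h) // ler_nat setIid subset_leq_card // subsetIl.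
exists U, (dilate s0^-1 S2); split => //.
- by rewrite card_dilate ?invr_eq0.
- rewrite -[X in X \in _](mulVf nzs0) mem_dilate //=.
  apply/imsetP => -[s]; rewrite inE => /andP[/nzS nzs _] /esym/eqP.
  by rewrite mulf_eq0 invr_eq0 (negPf nzs0) (negPf nzs).
move=> _ /imsetP[s + ->]; rewrite inE => /andP[Ss hs].
have nzs := nzS _ Ss.
pose D := V s0 :&: V s.
have DU : #|D|%:R * #|diffset U (dilate (s0^-1 * s) U)|%:R <= #|diffset U U|%:R ^+ 2 :> R.
  have -> : #|diffset U (dilate (s0^-1 * s) U)| = #|diffset (dilate s0 U) (dilate s U)|.
    rewrite -[in RHS](mulVKf nzs0 s) -(dilate_dilate s0); exact/esym/card_diffset_dilate.
  rewrite expr2 -!natrM ler_nat.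
  apply: leq_trans (ruzsa_triangle D (dilate s0 U) (dilate s U)) _.
  apply: leq_mul.
    rewrite -(card_diffset_dilate U U nzs0).
    rewrite -(card_diffset_translate (dilate s0 U) (dilate s0 U) (z s0)).
    apply/subset_leq_card/diffsetS => //; apply/subsetP => x.
    by rewrite !inE => /andP[/andP[_ ->]].
  rewrite card_diffsetC -(card_diffset_dilate U U nzs).
  rewrite -(card_diffset_translate (dilate s U) (dilate s U) (z s)).
  apply/subset_leq_card/diffsetS => //; apply/subsetP => x.
  by rewrite !inE => /andP[_ /andP[_ ->]].
(* From here on only constants: [#|diffset U U|] is at most
   [2 ^ 18 * #|U| / alpha ^ 6], and [thr * #|diffset U (dilate c U)|] is at
   most its square. *)
have D2 : (#|diffset U U|%:R * alpha ^+ 5) ^+ 2 <= 2%:R ^+ 36 * #|U|%:R ^+ 2 * (alpha ^- 1) ^+ 2.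
  apply: (@le_trans _ _ ((2%:R ^+ 15 * N) ^+ 2)).
    by rewrite ler_sqr ?nnegrE ?mulr_ge0 ?exprn_ge0 ?ler0n // ltW.
  have -> : 2%:R ^+ 36 * #|U|%:R ^+ 2 * alpha^-1 ^+ 2 = (2%:R ^+ 18 * (#|U|%:R / alpha)) ^+ 2 :> R.
    by rewrite (exprM 2%:R 18 2); move: (2%:R ^+ 18) => e; ring.
  rewrite ler_sqr ?nnegrE ?mulr_ge0 ?exprn_ge0 ?invr_ge0 ?ler0n ?(ltW alpha0) ?(ltW N0) //.
  rewrite mulrA ler_pdivlMr //; move: UN; lra.
have DU' : thr * #|diffset U (dilate (s0^-1 * s) U)|%:R <= #|diffset U U|%:R ^+ 2.
  by apply: le_trans DU; rewrite ler_wpM2r.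
have a12 : 0 < alpha ^+ 12 by rewrite exprn_gt0.
move: DU'; rewrite -(ler_pM2r a12) => DU'.
rewrite -(ler_pM2l U0) -(ler_pM2l (_ : 0 < 64%:R^-1)) ?invr_gt0 //.
apply: le_trans (_ : thr * #|diffset U (dilate (s0^-1 * s) U)|%:R * alpha ^+ 12 <= _).
  by rewrite /thr le_eqVlt; apply/orP; left; apply/eqP; ring.
apply: le_trans DU' _.
have -> : #|diffset U U|%:R ^+ 2 * alpha ^+ 12 =
   (#|diffset U U|%:R * alpha ^+ 5) ^+ 2 * alpha ^+ 2 by ring.
have a2 : 0 < alpha ^+ 2 by rewrite exprn_gt0.
apply: le_trans (_ : 2%:R ^+ 36 * #|U|%:R ^+ 2 * (alpha ^- 1) ^+ 2 * alpha ^+ 2 <= _).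
  by rewrite ler_pM2r.
rewrite le_eqVlt; apply/orP; left; apply/eqP; field; by rewrite gt_eqF.
Qed.

End ManyDilates.

(** * Ratio sets, subfields and multiplicative growth *)

Section Ratios.
Variable F : finFieldType.
Implicit Types (C D U W G : {set F}) (c r x : F).

Definition ratios C : {set F} :=
  [set (p.1.1 - p.1.2) / (p.2.1 - p.2.2) | p in setX (setX C C) (setX C C)].

Lemma ratiosP C r : reflect (exists c1 c2 c3 c4, [/\ c1 \in C, c2 \in C, c3 \in C, c4 \in C
    & r = (c1 - c2) / (c3 - c4)]) (r \in ratios C).
Proof.
apply: (iffP imsetP) => [[[[c1 c2] [c3 c4]] /setXP[/setXP[/= h1 h2] /setXP[/= h3 h4]] ->]|].
  by exists c1, c2, c3, c4.
case=> [c1 [c2 [c3 [c4 [h1 h2 h3 h4 ->]]]]].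
by exists ((c1, c2), (c3, c4)); rewrite ?inE /= ?h1 ?h2 ?h3 ?h4.
Qed.

Lemma imset_stable (I : finType) (f : I -> I) (S : {set I}) :
  injective f -> (forall i, i \in S -> f i \in S) -> f @: S = S.
Proof.
move=> injf fS; apply/eqP; rewrite eqEcard card_imset // leqnn andbT.
by apply/subsetP => _ /imsetP[x Sx ->]; apply: fS.
Qed.

(** The translations that preserve [ratios C] form an additive group [Add],
    stable under multiplication by [C] because [r + c * y] equals
    [c * (c^-1 * r + y)]. The stabilizer [W] of [Add] is then a field
    containing [C], hence [ratios C], while [W] is part of [Add] and [Add] is
    part of [ratios C]. *)
Lemma ratios_subfield C : C != set0 ->
  (forall r, r \in ratios C -> 1 + r \in ratios C) ->
  (forall c r, c \in C -> r \in ratios C -> c * r \in ratios C) ->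
  subfield_set (ratios C) /\ C \subset ratios C.
Proof.
set Q := ratios C => /set0Pn[c0 Cc0] addQ mulQ.
have Q0 : 0 \in Q.
  by apply/ratiosP; exists c0, c0, c0, c0; rewrite Cc0 subrr mul0r.
pose Add := [set y | [forall r in Q, r + y \in Q]].
have AddP y : reflect (forall r, r \in Q -> r + y \in Q) (y \in Add).
  by rewrite inE; apply: (iffP forall_inP).
have Add1 : 1 \in Add by apply/AddP => r Qr; rewrite addrC addQ.
have Add0 : 0 \in Add by apply/AddP => r; rewrite addr0.
have AddB y z : y \in Add -> z \in Add -> y - z \in Add.
  move=> /AddP Ay /AddP Az; apply/AddP => r /Ay.
  have stable : +%R^~ z @: Q = Q by apply: imset_stable => //; apply: addIr.
  by rewrite addrA -{1}stable => /imsetP[r' Qr' ->]; rewrite addrK.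
have AddM c y : c \in C -> y \in Add -> c * y \in Add.
  move=> Cc /AddP Ay; have [->|nzc] := eqVneq c 0; first by rewrite mul0r.
  have stable : *%R c @: Q = Q.
    by apply: imset_stable => [|x Qx]; [apply: mulfI | apply: mulQ].
  apply/AddP => r; rewrite -{1}stable => /imsetP[r' Qr' ->].
  by rewrite -mulrDr mulQ // Ay.
pose W := [set w | [forall y in Add, w * y \in Add]].
have WP w : reflect (forall y, y \in Add -> w * y \in Add) (w \in W).
  by rewrite inE; apply: (iffP forall_inP).
have WB w v : w \in W -> v \in W -> w - v \in W.
  by move=> /WP Ww /WP Wv; apply/WP => y Ay; rewrite mulrBl AddB ?Ww ?Wv.
have WV w v : w \in W -> v \in W -> w / v \in W.
  move=> /WP Ww /WP Wv; have [->|nzv] := eqVneq v 0.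
    by apply/WP => y _; rewrite invr0 mulr0 mul0r.
  have stable : *%R v @: Add = Add by apply: imset_stable => //; apply: mulfI.
  apply/WP => y; rewrite -{1}stable => /imsetP[y' Ay' ->].
  by rewrite mulrA mulfVK // Ww.
have W1 : 1 \in W by apply/WP => y; rewrite mul1r.
have CW : C \subset W by apply/subsetP => c Cc; apply/WP => y; apply: AddM.
have QW : Q = W.
  apply/setP => r; apply/idP/idP => [/ratiosP[c1 [c2 [c3 [c4 [h1 h2 h3 h4 ->]]]]]|].
    by apply: WV; apply: WB; apply: (subsetP CW).
  by move=> /WP/(_ 1 Add1); rewrite mulr1 => /AddP/(_ 0 Q0); rewrite add0r.
by rewrite QW.
Qed.

(** A collision [c + x * c' = d + x * d'] would exhibit [x] as a ratio. *)
Lemma card_linear_pairs C x : x \notin ratios C ->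
  #|[set p.1 + x * p.2 | p in setX C C]| = (#|C| ^ 2)%N.
Proof.
move=> nQx; rewrite card_in_imset ?cardsX ?mulnn //.
move=> [c c'] [d d'] /setXP[/= Cc Cc'] /setXP[/= Cd Cd'] e.
have [ec|nec] := eqVneq c' d'; first by move: e; rewrite ec => /addIr ->.
case/negP: nQx; apply/ratiosP; exists c, d, d', c'; split=> //.
have nz : d' - c' != 0 by rewrite subr_eq0 eq_sym.
apply: (mulIf nz); rewrite mulfVK // mulrBr.
by rewrite -[LHS](addrK (x * c' + c)) addrA subrK [x * c' + c]addrC e opprD; ring.
Qed.

End Ratios.

Section DilateSums.
Variables (R : realFieldType) (F : finFieldType) (U C : {set F}) (Q : R).
Hypotheses (U0 : U != set0) (C1 : 1 \in C) (C0 : 0 \notin C).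
Hypothesis close : forall c, c \in C -> #|diffset U (dilate c U)|%:R <= Q * #|U|%:R.

Let cU0 : 0 < #|U|%:R :> R. Proof. by rewrite ltr0n card_gt0. Qed.

Lemma card_diffset_ge (X Y : {set F}) : Y != set0 -> (#|X| <= #|diffset X Y|)%N.
Proof.
case/set0Pn => y Yy; rewrite -(card_imset _ (addIr (- y))).
by apply/subset_leq_card/subsetP => _ /imsetP[x Xx ->]; apply: mem_diffset.
Qed.

Let Q1 : 1 <= Q.
Proof.
have := close C1; rewrite dilate1 => h; rewrite -(ler_pM2r cU0) mul1r.
by apply: le_trans h; rewrite ler_nat card_diffset_ge.
Qed.
Let Q0 : 0 <= Q. Proof. exact: le_trans ler01 Q1. Qed.

Let span (D : {set F}) := \bigcup_(d in D) dilate d U.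

Let mem_span (D : {set F}) d u : d \in D -> u \in U -> d * u \in span D.
Proof. by move=> Dd Uu; apply/bigcupP; exists d; rewrite ?mem_dilate. Qed.

(* Applying Plunnecke's inequality to the union of the dilates costs only a
   constant factor compared with its version for different summands. *)
Let span_sums (D : {set F}) m l : D \subset C -> (#|D| <= 4)%N ->
  #|diffset (nsum m (span D)) (nsum l (span D))|%:R <= (4%:R * Q) ^+ (m + l) * #|U|%:R.
Proof.
move=> sDC D4; pose U' := [set - x | x in U].
have cU' : #|U'| = #|U| by rewrite card_imset //; apply: oppr_inj.
rewrite -cU'; apply: plunnecke_ruzsa; first by rewrite -card_gt0 cU' card_gt0.
  by rewrite mulr_ge0 ?ler0n.
rewrite cU' sumset_opp card_diffsetC.
have sub : diffset U (span D) \subset \bigcup_(d in D) diffset U (dilate d U).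
  apply/subsetP => _ /imset2P[u w Uu /bigcupP[d Dd dw] ->].
  by apply/bigcupP; exists d => //; apply: mem_diffset.
apply: (@le_trans _ _ (\sum_(d in D) #|diffset U (dilate d U)|%:R)).
  rewrite -natr_sum ler_nat; apply: leq_trans (subset_leq_card sub) _.
  elim/big_rec2: _ => [|d k X _ h]; first by rewrite cards0.
  by apply: leq_trans (leq_card_setU _ _) _; rewrite leq_add2l.
apply: (@le_trans _ _ (\sum_(d in D) (Q * #|U|%:R))).
  by apply: ler_sum => d /(subsetP sDC)/close.
rewrite sumr_const -[leLHS]mulr_natl -mulrA ler_wpM2r ?mulr_ge0 ?ler0n //.
by rewrite ler_nat.
Qed.

Let powers i j : (i <= j)%N -> (4%:R * Q) ^+ i * #|U|%:R <= (4%:R * Q) ^+ j * #|U|%:R.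
Proof.
move=> le_ij; rewrite ler_wpM2r ?ler0n // ler_weXn2l //.
by apply: le_trans Q1 _; rewrite ler_peMl // ler1n.
Qed.

Let Q_le j : (0 < j)%N -> Q * #|U|%:R <= (4%:R * Q) ^+ j * #|U|%:R.
Proof.
move=> j0; apply: le_trans (powers j0).
by rewrite expr1 ler_wpM2r ?ler0n // ler_peMl // ler1n.
Qed.

(** After multiplication by [c3 - c4], the differences in question lie in
    [c3 * U + c2 * U - (c4 * U + c1 * U)]. *)
Lemma close_ratio r : r \in ratios C ->
  #|diffset U (dilate r U)|%:R <= (4%:R * Q) ^+ 4 * #|U|%:R.
Proof.
case/ratiosP => c1 [c2 [c3 [c4 [h1 h2 h3 h4 ->]]]].
have [->|nz] := eqVneq (c3 - c4) 0.
  rewrite invr0 mulr0; apply: le_trans (_ : #|U|%:R <= _); last first.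
    by apply: le_trans (powers (leq0n 4)); rewrite expr0 mul1r.
  rewrite ler_nat; have -> : dilate 0 U = [set 0].
    case/set0Pn: U0 => u Uu; apply/setP => w; rewrite inE.
    by apply/imsetP/eqP => [[x _ ->]|->]; [rewrite mul0r | exists u; rewrite ?mul0r].
  rewrite -[leqRHS](card_imset _ (addIr (- 0))) subset_leq_card //.
  by apply/subsetP => _ /imset2P[x y Ux /set1P-> ->]; apply/imsetP; exists x.
pose D := [set c1; c2; c3; c4].
have sD : D \subset C by apply/subsetP => d; rewrite !inE -!orbA => /or4P[]/eqP->.
have D4 : (#|D| <= 4)%N.
  apply: leq_trans (card_size [:: c1; c2; c3; c4]); apply/subset_leq_card/subsetP => d.
  by rewrite !inE -!orbA.
apply: le_trans (_ : _ <= _) (span_sums 2 2 sD D4).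
rewrite -(card_diffset_dilate _ _ nz) dilate_dilate mulrC mulfVK // ler_nat.
apply/subset_leq_card/subsetP => _ /imset2P[_ _ /imsetP[u Uu ->] /imsetP[v Uv ->] ->].
have -> : (c3 - c4) * u - (c1 - c2) * v = (c3 * u + c2 * v) - (c4 * u + c1 * v) by ring.
by apply: mem_diffset; apply: mem_nsumS; rewrite ?mem_nsum1 ?mem_span // !inE eqxx ?orbT.
Qed.

Lemma close_succ_ratio r : r \in ratios C ->
  #|diffset U (dilate (1 + r) U)|%:R <= (4%:R * Q) ^+ 6 * #|U|%:R.
Proof.
case/ratiosP => c1 [c2 [c3 [c4 [h1 h2 h3 h4 ->]]]].
have [->|nz] := eqVneq (c3 - c4) 0.
  by rewrite invr0 mulr0 addr0; apply: le_trans (close C1) (Q_le _).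
pose D := [set c1; c2; c3; c4].
have sD : D \subset C by apply/subsetP => d; rewrite !inE -!orbA => /or4P[]/eqP->.
have D4 : (#|D| <= 4)%N.
  apply: leq_trans (card_size [:: c1; c2; c3; c4]); apply/subset_leq_card/subsetP => d.
  by rewrite !inE -!orbA.
apply: le_trans (_ : _ <= _) (span_sums 3 3 sD D4).
rewrite -(card_diffset_dilate _ _ nz) dilate_dilate mulrDr mulr1 mulrCA mulfV // mulr1 ler_nat.
apply/subset_leq_card/subsetP => _ /imset2P[_ _ /imsetP[u Uu ->] /imsetP[v Uv ->] ->].
have -> : (c3 - c4) * u - (c3 - c4 + (c1 - c2)) * v =
  (c3 * u + (c4 * v + c2 * v)) - (c4 * u + (c3 * v + c1 * v)) by ring.
by apply: mem_diffset; do 2?apply: mem_nsumS; rewrite ?mem_nsum1 ?mem_span // !inE eqxx ?orbT.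
Qed.

Let triangle c r (K : R) : c != 0 -> 0 <= K ->
  #|diffset U (dilate c U)|%:R <= K * #|U|%:R ->
  #|diffset U (dilate (c * r) U)|%:R <= K * #|diffset U (dilate r U)|%:R.
Proof.
move=> nzc K0 h; have := ruzsa_triangle (dilate c U) U (dilate (c * r) U).
rewrite -dilate_dilate card_diffset_dilate // card_dilate // -(ler_nat R) !natrM => hr.
rewrite -(ler_pM2l cU0); apply: le_trans hr _.
by rewrite mulrA [#|U|%:R * K]mulrC ler_wpM2r ?ler0n.
Qed.

Lemma close_mul_ratio c r : c \in C -> r \in ratios C ->
  #|diffset U (dilate (c * r) U)|%:R <= (4%:R * Q) ^+ 6 * #|U|%:R.
Proof.
move=> Cc Qr; have nzc : c != 0 by apply: contraNneq C0 => <-.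
apply: le_trans (triangle _ nzc Q0 (close Cc)) _.
apply: le_trans (ler_wpM2l Q0 (close_ratio Qr)) _.
apply: le_trans (powers (isT : (5 <= 6)%N)); rewrite [leRHS](_ : _ =
  4%:R * (Q * ((4%:R * Q) ^+ 4 * #|U|%:R))); last by ring.
by rewrite ler_peMl ?ler1n // mulr_ge0 // mulr_ge0 ?ler0n ?exprn_ge0 // mulr_ge0 ?ler0n.
Qed.

(** Two applications of the triangle inequality through [U]: the set
    [U - c * U - U] costs three factors, and [x * c' * U] costs those of [x]
    and of [c']. *)
Lemma close_linear_pair x c c' : x != 0 -> c \in C -> c' \in C ->
  #|diffset U (dilate x U)|%:R <= (4%:R * Q) ^+ 6 * #|U|%:R ->
  #|diffset U (dilate (c + x * c') U)|%:R <= (4%:R * Q) ^+ 10 * #|U|%:R.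
Proof.
move=> nzx Cc Cc' hx.
have K6 : 0 <= (4%:R * Q) ^+ 6 by rewrite exprn_ge0 // mulr_ge0 ?ler0n.
have hxc : #|diffset U (dilate (x * c') U)|%:R <= (4%:R * Q) ^+ 6 * (Q * #|U|%:R).
  by apply: le_trans (triangle _ nzx K6 hx) _; rewrite ler_wpM2l // close.
pose D := [set 1; c].
have sD : D \subset C by apply/subsetP => d; rewrite !inE => /orP[]/eqP->.
have D4 : (#|D| <= 4)%N by rewrite /D cards2; case: (_ != _).
have hD : #|diffset (diffset U (dilate c U)) U|%:R <= (4%:R * Q) ^+ 3 * #|U|%:R.
  apply: le_trans (_ : _ <= _) (span_sums 1 2 sD D4); rewrite ler_nat.
  apply/subset_leq_card/subsetP => _ /imset2P[_ w /imset2P[u _ Uu /imsetP[v Uv ->] ->] Uw ->].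
  have -> : u - c * v - w = 1 * u - (c * v + 1 * w) by ring.
  by apply: mem_diffset; rewrite ?mem_nsumS ?mem_nsum1 ?mem_span // !inE eqxx ?orbT.
have := ruzsa_triangle U (diffset U (dilate c U)) (dilate (x * c') U).
rewrite -(ler_nat R) !natrM => hr.
rewrite -(ler_pM2l cU0).
apply: le_trans (_ : #|U|%:R * #|diffset (diffset U (dilate c U)) (dilate (x * c') U)|%:R <= _).
  rewrite ler_wpM2l ?ler0n // ler_nat; apply/subset_leq_card/subsetP.
  move=> _ /imset2P[u _ Uu /imsetP[v Uv ->] ->].
  have -> : u - (c + x * c') * v = u - c * v - x * c' * v by ring.
  by apply: mem_diffset; rewrite ?mem_dilate // mem_diffset ?mem_dilate.
apply: le_trans hr _.
apply: le_trans (ler_pM _ _ hD hxc) _; rewrite ?ler0n //.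
rewrite [leLHS](_ : _ = #|U|%:R * (Q * ((4%:R * Q) ^+ 9 * #|U|%:R))); last by ring.
rewrite ler_wpM2l ?ler0n //.
rewrite [leRHS](_ : _ = 4%:R * (Q * ((4%:R * Q) ^+ 9 * #|U|%:R))); last by ring.
by rewrite ler_peMl ?ler1n // mulr_ge0 // mulr_ge0 ?ler0n ?exprn_ge0 // mulr_ge0 ?ler0n.
Qed.

End DilateSums.

(** Cauchy-Schwarz for the fibers of [f]: few values force many collisions. *)
Lemma collisions (R : realFieldType) (I J : finType) (S : {set I}) (f : I -> J) :
  #|S|%:R ^+ 2 <= #|f @: S|%:R * \sum_(p in S) \sum_(p' in S) (f p == f p')%:R :> R.
Proof.
pose rep w : R := \sum_(p in S) (f p == w)%:R.
have sum_rep : \sum_(w in f @: S) rep w = #|S|%:R.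
  rewrite exchange_big /= -sum1_card natr_sum; apply: eq_bigr => p Sp.
  rewrite (bigD1 (f p)) ?imset_f //= eqxx big1 ?addr0 // => w /andP[_].
  by rewrite eq_sym => /negPf ->.
have -> : \sum_(p in S) \sum_(p' in S) (f p == f p')%:R = \sum_(w in f @: S) rep w ^+ 2 :> R.
  under [RHS]eq_bigr do rewrite expr2 mulr_suml.
  rewrite [RHS]exchange_big /=; apply: eq_bigr => p Sp.
  rewrite (bigD1 (f p)) ?imset_f //= [X in _ + X]big1 ?addr0 ?eqxx ?mul1r.
    by apply: eq_bigr => p' _; rewrite eq_sym.
  by move=> w /andP[_ /negPf]; rewrite eq_sym => ->; rewrite mul0r.
by rewrite -[in leLHS]sum_rep cauchy_schwarz_card.
Qed.

(** The energies of the pairs [(U, r * U)], summed over [r] in [W], count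
    solutions of [u1 - u2 = r * (u3 - u4)]; once [u2], [u3] and [u4] are
    fixed with [u3 != u4], the point [u1] determines [r] and lies in
    [(u3 - u4) * G + u2]. *)
Lemma close_dilates_in_subfield (R : realFieldType) (F : finFieldType)
    (U W G : {set F}) (P mu : R) :
  W \subset G -> 0 < P -> 2%:R * P <= #|U|%:R ->
  (forall r, r \in W -> #|diffset U (dilate r U)|%:R <= P * #|U|%:R) ->
  (forall c d, #|U :&: affine_image c d G|%:R <= mu) ->
  #|W|%:R <= 2%:R * P * mu.
Proof.
move=> sWG P0 PU close hmu.
have U0 : 0 < #|U|%:R :> R by apply: lt_le_trans PU; rewrite mulr_gt0 ?ltr0n.
have mu0 : 0 <= mu by apply: le_trans (hmu 0 0); rewrite ler0n.
pose E r : R := \sum_(p in setX U U) \sum_(p' in setX U U)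
  (p.1 - r * p.2 == p'.1 - r * p'.2)%:R.
have lower r : r \in W -> #|U|%:R ^+ 3 <= P * E r.
  move=> Wr; rewrite -(ler_pM2l U0).
  apply: (@le_trans _ _ (#|diffset U (dilate r U)|%:R * E r)).
    have := collisions R (setX U U) (fun p => p.1 - r * p.2).
    rewrite cardsX natrM -expr2 -exprM -exprS.
    suff -> : [set p.1 - r * p.2 | p in setX U U] = diffset U (dilate r U) by [].
    apply/setP => w; apply/imsetP/imset2P => [[[u v] /setXP[/= Uu Uv] ->]|].
      by exists u (r * v); rewrite ?mem_dilate.
    by case=> u _ Uu /imsetP[v Uv ->] ->; exists (u, v); rewrite ?inE ?Uu.
  rewrite mulrA [#|U|%:R * P]mulrC ler_wpM2r ?close //.
  by apply: sumr_ge0 => p _; apply: sumr_ge0.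
have upper : \sum_(r in W) E r <= #|U|%:R ^+ 2 * (#|W|%:R + #|U|%:R * mu).
  rewrite exchange_big /=.
  apply: (@le_trans _ _ (\sum_(p in setX U U) (#|W|%:R + #|U|%:R * mu))); last first.
    by rewrite sumr_const cardsX -[leLHS]mulr_natl natrM expr2.
  apply: ler_sum => -[u2 u4] /setXP[/= Uu2 Uu4].
  rewrite exchange_big /=.
  rewrite [leLHS](_ : _ = \sum_(u3 in U) \sum_(u1 in U) \sum_(r in W)
      (u2 - r * u4 == u1 - r * u3)%:R); last first.
    rewrite [RHS]exchange_big /= [RHS]pair_big /=.
    by apply: eq_bigl => -[u1 u3]; rewrite inE.
  apply: (@le_trans _ _ (\sum_(u3 in U) ((u3 == u4)%:R * #|W|%:R + mu))).
    apply: ler_sum => u3 Uu3; have [->|neu] := eqVneq u3 u4.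
      rewrite mul1r; apply: ler_wpDr => //.
      rewrite (bigD1 u2) //= [X in _ + X]big1 => [|u1 /andP[_ ne]].
        rewrite addr0 -sum1_card natr_sum; apply: ler_sum => r _.
        by rewrite eqxx.
      by rewrite big1 // => r _; rewrite (inj_eq (addIr _)) eq_sym (negPf ne).
    rewrite mul0r add0r; apply: le_trans (hmu (u3 - u4) u2).
    rewrite -sum1_card natr_sum big_mkcond [leRHS]big_mkcond.
    apply: ler_sum => u1 _; rewrite inE; case: (u1 \in U) => //=.
    have nz : u3 - u4 != 0 by rewrite subr_eq0.
    have eqr r : (u2 - r * u4 == u1 - r * u3) = (r == (u1 - u2) / (u3 - u4)).
      apply/eqP/eqP => [e|->]; last by field.
      have -> : u1 = u2 - r * u4 + r * u3 by rewrite e subrK.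
      by field.
    under eq_bigr do rewrite eqr.
    have [Wr|nWr] := boolP ((u1 - u2) / (u3 - u4) \in W); last first.
      rewrite big1 => [|r Wr]; first by case: ifP; rewrite ?ler01.
      by case: eqP => // er; rewrite -er Wr in nWr.
    rewrite (bigD1 _ Wr) /= eqxx big1 ?addr0 => [|r /andP[_ /negPf->] //].
    rewrite ifT // /affine_image; apply/imsetP.
    exists ((u1 - u2) / (u3 - u4)); first exact: (subsetP sWG).
    by rewrite mulrC mulfVK // subrK.
  rewrite big_split /= sumr_const -[X in _ + X]mulr_natl lerD2r.
  rewrite (bigD1 u4) //= eqxx mul1r big1 ?addr0 // => u /andP[_ /negPf->].
  by rewrite mul0r.
have : #|W|%:R * #|U|%:R ^+ 3 <= P * (#|U|%:R ^+ 2 * (#|W|%:R + #|U|%:R * mu)).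
  apply: le_trans (ler_wpM2l (ltW P0) upper).
  by rewrite mulr_sumr mulr_natl -sumr_const; apply: ler_sum.
have U2 : 0 < #|U|%:R ^+ 2 :> R by rewrite exprn_gt0.
rewrite [leRHS]mulrCA [leLHS](_ : _ = #|U|%:R ^+ 2 * (#|W|%:R * #|U|%:R)); last by ring.
rewrite ler_pM2l // => h.
have h2 : #|W|%:R * (2%:R * P) <= #|W|%:R * #|U|%:R by rewrite ler_wpM2l ?ler0n.
rewrite -(ler_pM2r U0).
move: h h2; move: (#|W|%:R : R) (#|U|%:R : R) => w u; lra.
Qed.

(** * Alternatives for a rich set of slopes *)

Section Alternatives.
Variables (R : realFieldType) (F : finFieldType) (A S : {set F}) (n alpha : R).
Let N : R := #|A|%:R.
Hypotheses (alpha0 : 0 < alpha) (alpha1 : alpha <= 1) (n0 : 0 < n) (A0 : A != set0).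
Hypotheses (S0 : 0 \notin S) (Sn : #|S|%:R <= n).
Hypothesis rich : alpha * N ^+ 2 * n <=
  \sum_(s in S) \sum_(u in A) #|[set x in A | x - s * u \in dilate (1 - s) A]|%:R.

(** [Q] bounds the expansion of [U] under each [c] in [C]. If [ratios C] is
    not a field, an element [x] outside it makes [c + x * c'] run over
    [#|C| ^ 2] multipliers under which [U] hardly grows. If it is a field,
    [U] hardly grows under all its elements. In all cases
    [close_dilates_in_subfield] limits the number of such multipliers; the
    first and third alternatives use it in the whole field, the last one in
    the proper subfield [ratios C], once for [C] and once for the subfield.
    The second alternative is the degenerate case in which [U] is too small
    for that lemma. The numbers come from [Q = 2 ^ 42 / alpha ^ 15] and from
    the exponents 4 and 10 of [close_ratio] and [close_linear_pair]. *)
Lemma rich_alternatives : [\/ alpha ^+ 156 * n ^+ 2 <= 2%:R ^+ 453 * N,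
    alpha ^+ 151 * N <= 2%:R ^+ 444,
    alpha ^+ 60 * #|F|%:R <= 2%:R ^+ 177 * N
  | exists2 G : {set F}, proper_subfield G &
      alpha ^+ 3 * n <= 2%:R ^+ 6 * #|G|%:R /\
      forall mu, (forall c d, #|A :&: affine_image c d G|%:R <= mu) ->
        alpha ^+ 18 * n <= 2%:R ^+ 49 * mu /\ alpha ^+ 60 * #|G|%:R <= 2%:R ^+ 177 * mu].
Proof.
have [U [C [sUA UN Cn /andP[C1 C0] close]]] := many_dilates alpha0 n0 A0 S0 Sn rich.
have N0 : 0 < N by rewrite ltr0n card_gt0.
have apos k : 0 < alpha ^+ k by rewrite exprn_gt0.
have U0 : 0 < #|U|%:R :> R by apply: lt_le_trans UN; rewrite !mulr_gt0 ?invr_gt0.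
have nzU : U != set0 by rewrite -card_gt0 -(ltr0n R).
have UA : #|U|%:R <= N by rewrite ler_nat subset_leq_card.
pose Q : R := 2%:R ^+ 42 / alpha ^+ 15.
have closeQ c : c \in C -> #|diffset U (dilate c U)|%:R <= Q * #|U|%:R.
  by move=> /close h; rewrite /Q mulrAC ler_pdivlMr.
have Q0 : 0 < Q by rewrite divr_gt0 ?exprn_gt0.
have Q1 : 1 <= Q.
  rewrite ler_pdivlMr // mul1r; apply: le_trans (_ : 1 <= _).
    by rewrite exprn_ile1 // ltW.
  by rewrite exprn_ege1 // ler1n.
have Q41 : 1 <= 4%:R * Q by apply: le_trans Q1 _; rewrite ler_peMl ?ler1n // ltW.
have Qpow k : (4%:R * Q) ^+ k = 2%:R ^+ (44 * k) / alpha ^+ (15 * k).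
  by rewrite !exprM -expr_div_n; congr (_ ^+ k); rewrite /Q mulrA; congr (_ / _); ring.
have Ppos k : 0 < (4%:R * Q) ^+ k by rewrite exprn_gt0 // mulr_gt0.
have [small|large] := ltP #|U|%:R (2%:R * (4%:R * Q) ^+ 10).
  constructor 2; rewrite -(ler_pM2r (_ : 0 < 8%:R^-1)) ?invr_gt0 //.
  move: (le_lt_trans UN small); rewrite Qpow mulrA ltr_pdivlMr // => /ltW h.
  rewrite [leLHS](_ : _ = alpha * N / 8%:R * alpha ^+ (15 * 10)); last first.
    by rewrite (exprS _ 150); ring.
  apply: le_trans h _.
  rewrite (_ : 444 = (44 * 10) + 4)%N // exprD; move: (2%:R ^+ (44 * 10)) => e; lra.
have large4 : 2%:R * (4%:R * Q) ^+ 4 <= #|U|%:R.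
  by apply: le_trans large; rewrite ler_pM2l // ler_weXn2l.
have largeQ : 2%:R * Q <= #|U|%:R.
  apply: le_trans large4; rewrite ler_pM2l //.
  apply: le_trans (_ : (4%:R * Q) ^+ 1 <= _); last by rewrite ler_weXn2l.
  by rewrite expr1 ler_peMl ?ler1n // ltW.
have whole c d : #|U :&: affine_image c d [set: F]|%:R <= N.
  by apply: le_trans UA; rewrite ler_nat subset_leq_card // subsetIl.
have [/existsP[x /andP[nQx hx]]|/existsPn no] := boolP [exists x, (x \notin ratios C) &&
    (#|diffset U (dilate x U)|%:R <= (4%:R * Q) ^+ 6 * #|U|%:R)].
  constructor 1.
  have nzx : x != 0.
    apply: contraNneq nQx => ->; apply/ratiosP; exists 1, 1, 1, 1.
    by rewrite C1 subrr mul0r.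
  pose W := [set p.1 + x * p.2 | p in setX C C].
  have cW : #|W|%:R <= 2%:R * (4%:R * Q) ^+ 10 * N.
    apply: (close_dilates_in_subfield (subsetT W) (Ppos 10) large) => // r.
    case/imsetP => -[c c'] /setXP[/= Cc Cc'] ->.
    exact: (close_linear_pair nzU C1 closeQ nzx Cc Cc' hx).
  rewrite card_linear_pairs // natrX Qpow mulrA in cW.
  rewrite mulrAC ler_pdivlMr // in cW.
  rewrite -(ler_pM2r (_ : 0 < (64%:R^-1) ^+ 2)) ?exprn_gt0 ?invr_gt0 //.
  rewrite [leLHS](_ : _ = (alpha ^+ 3 * n / 64%:R) ^+ 2 * alpha ^+ (15 * 10)); last first.
    by rewrite (exprD _ 6 150); ring.
  apply: le_trans (_ : #|C|%:R ^+ 2 * alpha ^+ (15 * 10) <= _).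
    by rewrite ler_pM2r // ler_sqr ?nnegrE // divr_ge0 // mulr_ge0 ?ltW.
  apply: le_trans cW _.
  rewrite [453%N](_ : _ = (44 * 10 + 13)%N) // exprD.
  by move: (2%:R ^+ (44 * 10)) => e; lra.
have xQ x : #|diffset U (dilate x U)|%:R <= (4%:R * Q) ^+ 6 * #|U|%:R -> x \in ratios C.
  by move=> hx; have := no x; rewrite hx andbT negbK.
have [|||sub sCQ] := @ratios_subfield F C.
- by apply/set0Pn; exists 1.
- by move=> r Qr; apply/xQ/(close_succ_ratio nzU C1 closeQ).
- by move=> c r Cc Qr; apply/xQ/(close_mul_ratio nzU C1 C0 closeQ).
have closeR r : r \in ratios C -> #|diffset U (dilate r U)|%:R <= (4%:R * Q) ^+ 4 * #|U|%:R.
  exact: (close_ratio nzU C1 closeQ).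
have [full|proper] := eqVneq (ratios C) [set: F].
  constructor 3.
  have : #|ratios C|%:R <= 2%:R * (4%:R * Q) ^+ 4 * N.
    by apply: (close_dilates_in_subfield (subsetT _) (Ppos 4) large4).
  rewrite full cardsT Qpow mulrA mulrAC ler_pdivlMr // mulrC => h.
  by apply: le_trans h _; rewrite (_ : 177 = 44 * 4 + 1)%N // exprD; lra.
constructor 4; exists (ratios C); first by split=> //; rewrite properEneq proper subsetT.
split.
  have : #|C|%:R <= #|ratios C|%:R :> R by rewrite ler_nat subset_leq_card.
  move=> /(le_trans Cn); rewrite ler_pdivrMr // => h.
  by apply: le_trans h _; rewrite mulrC ler_wpM2r // -natrX ler_nat.
move=> mu hmu.
have hU c d : #|U :&: affine_image c d (ratios C)|%:R <= mu.
  by apply: le_trans (hmu c d); rewrite ler_nat subset_leq_card // setSI.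
split.
  have := close_dilates_in_subfield sCQ Q0 largeQ closeQ hU.
  move=> /(le_trans Cn).
  rewrite [leRHS](_ : _ = 2%:R * 2%:R ^+ 42 * mu / alpha ^+ 15); last first.
    by rewrite /Q; ring.
  rewrite ler_pdivlMr //.
  rewrite -(ler_pM2r (_ : 0 < 64%:R)) // => h.
  rewrite [leLHS](_ : _ = alpha ^+ 3 * n / 64%:R * alpha ^+ 15 * 64%:R); last first.
    by rewrite (exprD _ 3 15); field.
  apply: le_trans h _; rewrite (_ : 49 = 42 + 7)%N // exprD; move: (2%:R ^+ 42) => e; lra.
have := close_dilates_in_subfield (subxx _) (Ppos 4) large4 closeR hU.
rewrite Qpow mulrA mulrAC ler_pdivlMr // mulrC => h.
by apply: le_trans h _; rewrite (_ : 177 = 44 * 4 + 1)%N // exprD; lra.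
Qed.

End Alternatives.

(** * Collinear triples as solutions indexed by slopes *)

Section Triples.
Variables (F : finFieldType) (A B : {set F}).

Let sum_triples (D : {set F}) (G : F * F * F -> nat) :
  (\sum_(x in D) \sum_(y in D) \sum_(z in D) G (x, y, z) =
   \sum_(t | [&& t.1.1 \in D, t.1.2 \in D & t.2 \in D]) G t)%N.
Proof.
rewrite pair_big /= pair_big /=.
by apply: eq_big => [[[x y] z]|[[x y] z] _] //=; rewrite andbA.
Qed.

Lemma T_sum : T A B = (\sum_(b1 in B) \sum_(b2 in B) \sum_(b3 in B)
  \sum_(a1 in A) \sum_(a2 in A) \sum_(a3 in A)
    ((a2 - a1) * (b3 - b1) == (a3 - a1) * (b2 - b1))%R)%N.
Proof.
rewrite (sum_triples B (fun b => \sum_(a1 in A) \sum_(a2 in A) \sum_(a3 in A)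
    ((a2 - a1) * (b.2 - b.1.1) == (a3 - a1) * (b.1.2 - b.1.1))%R)%N).
rewrite (eq_bigr (fun b => \sum_(a | [&& a.1.1 \in A, a.1.2 \in A & a.2 \in A])
  ((a.1.2 - a.1.1) * (b.2 - b.1.1) == (a.2 - a.1.1) * (b.1.2 - b.1.1))%R)%N); last first.
  by move=> b _; rewrite -sum_triples.
rewrite exchange_big pair_big /= /T -sum1_card big_mkcond [RHS]big_mkcond.
apply: eq_bigr => -[[[a1 a2] a3] [[b1 b2] b3]] _ /=; rewrite inE.
by do 6!case: (_ \in _) => //=; case: (_ == _).
Qed.

(** For [s != 1] this is the number of triples of [A] with
    [a2 - s * a3 = (1 - s) * a1], since [a2] and [a3] determine [a1]. *)
Definition slope_graph_size (s : F) : nat :=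
  (\sum_(u in A) #|[set x in A | (x - s * u)%R \in dilate (1 - s)%R A]|)%N.

Definition slopes (b1 b3 : F) : {set F} :=
  [set (b - b1) / (b3 - b1) | b in B :\ b1 :\ b3].

Let sum_eq_le (D : {set F}) (c : F) : (\sum_(a in D) (a == c) <= 1)%N.
Proof.
rewrite -cardIsum; apply: leq_trans (_ : #|[set c]| <= _)%N; last by rewrite cards1.
by apply/subset_leq_card/subsetP => a; rewrite !inE => /andP[].
Qed.

Let count (b1 b2 b3 : F) := (\sum_(a1 in A) \sum_(a2 in A) \sum_(a3 in A)
    ((a2 - a1) * (b3 - b1) == (a3 - a1) * (b2 - b1))%R)%N.

Let count_le_cube b1 b2 b3 : (count b1 b2 b3 <= #|A| ^ 3)%N.
Proof.
apply: (@leq_trans (\sum_(a1 in A) \sum_(a2 in A) \sum_(a3 in A) 1)%N).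
  by do 3!apply: leq_sum => ? _; case: (_ == _).
by rewrite !sum_nat_const muln1 mulnn -expnS.
Qed.

Let sum_const2 : (\sum_(x in A) \sum_(y in A) 1 = #|A| ^ 2)%N.
Proof. by rewrite !sum_nat_const muln1. Qed.

Let count_first b1 b2 : b2 != b1 -> (count b1 b2 b1 <= #|A| ^ 2)%N.
Proof.
move=> ne; rewrite -sum_const2; do 2!apply: leq_sum => ? _.
apply: leq_trans (sum_eq_le A _); apply: leq_sum => a3 _.
by rewrite subrr mulr0 eq_sym mulf_eq0 (subr_eq0 b2) (negPf ne) orbF subr_eq0.
Qed.

Let count_second b1 b3 : b3 != b1 -> (count b1 b1 b3 <= #|A| ^ 2)%N.
Proof.
move=> ne; rewrite -sum_const2; apply: leq_sum => a1 _.
rewrite exchange_big /=; apply: leq_sum => a3 _.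
apply: leq_trans (sum_eq_le A a1); apply: leq_sum => a2 _.
by rewrite subrr mulr0 mulf_eq0 (subr_eq0 b3) (negPf ne) orbF subr_eq0.
Qed.

Let count_third b1 b3 : b3 != b1 -> (count b1 b3 b3 <= #|A| ^ 2)%N.
Proof.
move=> ne; rewrite -sum_const2; apply: leq_sum => a1 _.
apply: leq_sum => a2 _.
apply: leq_trans (sum_eq_le A a2); apply: leq_sum => a3 _.
have nz : b3 - b1 != 0 by rewrite subr_eq0.
by rewrite (inj_eq (mulIf nz)) (inj_eq (addIr _)) eq_sym.
Qed.

Let count_generic b1 b2 b3 : b3 != b1 -> b2 != b1 -> b2 != b3 ->
  (count b1 b2 b3 <= slope_graph_size ((b2 - b1) / (b3 - b1)))%N.
Proof.
move=> ne31 ne21 ne23; set s := _ / _.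
have nz31 : b3 - b1 != 0 by rewrite subr_eq0.
have nz1s : 1 - s != 0.
  by rewrite subr_eq0 eq_sym -(inj_eq (mulIf nz31)) mul1r mulfVK // (inj_eq (addIr _)).
rewrite /count exchange_big /=.
rewrite (eq_bigr (fun a2 => \sum_(a3 in A) \sum_(a1 in A)
    ((a2 - a1) * (b3 - b1) == (a3 - a1) * (b2 - b1))%R)%N); last first.
  by move=> a2 _; rewrite exchange_big.
rewrite exchange_big /= /slope_graph_size; apply: leq_sum => u _.
rewrite cardIsum; apply: leq_sum => x _.
have eqs a1 : ((x - a1) * (b3 - b1) == (u - a1) * (b2 - b1)) = (a1 == (x - s * u) / (1 - s)).
  have -> : b2 - b1 = s * (b3 - b1) by rewrite mulfVK.
  rewrite mulrA (inj_eq (mulIf nz31)).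
  apply/eqP/eqP => [e|->]; last by field.
  have -> : x = (u - a1) * s + a1 by rewrite -e subrK.
  by field.
under eq_bigr do rewrite eqs.
have [|nA] := boolP (x - s * u \in _); first by rewrite sum_eq_le.
rewrite big1 // => a1 Aa1; case: eqP => // e; case/negP: nA.
by apply/imsetP; exists a1 => //; rewrite e; field.
Qed.

(** Triples with a repeated second coordinate contribute at most
    [4 * #|A| ^ 3 * #|B|]. When [b1], [b2] and [b3] are distinct, the
    condition reads [a2 - s * a3 = (1 - s) * a1], with the slope
    [s = (b2 - b1) / (b3 - b1)]. *)
Lemma T_le_slopes : (#|B| <= #|A|)%N ->
  (T A B <= 4 * #|A| ^ 3 * #|B| +
     \sum_(b1 in B) \sum_(b3 in B | b3 != b1) \sum_(s in slopes b1 b3) slope_graph_size s)%N.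
Proof.
move=> leBA.
have -> : T A B = (\sum_(b1 in B) \sum_(b3 in B) \sum_(b2 in B) count b1 b2 b3)%N.
  by rewrite T_sum; apply: eq_bigr => b1 _; rewrite exchange_big.
have diag b1 : b1 \in B ->
    (\sum_(b2 in B) count b1 b2 b1 <= #|A| ^ 3 + #|B| * #|A| ^ 2)%N.
  move=> Bb1; rewrite (bigD1 b1) //= leq_add ?count_le_cube //.
  apply: (@leq_trans (\sum_(b2 in B) #|A| ^ 2)%N); last by rewrite sum_nat_const.
  rewrite big_mkcondr /=; apply: leq_sum => b2 _; case: ifP => // ne.
  exact: count_first.
have offdiag b1 b3 : b1 \in B -> b3 \in B -> b3 != b1 -> (\sum_(b2 in B) count b1 b2 b3 <=
    2 * #|A| ^ 2 + \sum_(s in slopes b1 b3) slope_graph_size s)%N.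
  move=> Bb1 Bb3 ne; rewrite (bigD1 b1) //= (bigD1 b3) /=; last by rewrite Bb3.
  rewrite addnA leq_add //; first by rewrite mul2n -addnn leq_add ?count_second ?count_third.
  have nz : b3 - b1 != 0 by rewrite subr_eq0.
  rewrite big_imset /=; last first.
    by move=> x y _ _ /(mulIf _)-/(_ (invr_neq0 nz))/addIr.
  rewrite [leqRHS](eq_bigl (fun b => [&& b \in B, b != b1 & b != b3])); last first.
    by move=> b; rewrite !inE; case: (b != b3); case: (b != b1); case: (b \in B).
  rewrite [leqLHS](eq_bigl (fun b => [&& b \in B, b != b1 & b != b3])); last first.
    by move=> b; rewrite andbA.
  by apply: leq_sum => b2 /and3P[_ h1 h3]; apply: count_generic.
apply: (@leq_trans (\sum_(b1 in B) ((#|A| ^ 3 + #|B| * #|A| ^ 2) +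
    \sum_(b3 in B | b3 != b1) (2 * #|A| ^ 2 + \sum_(s in slopes b1 b3) slope_graph_size s)))%N).
  apply: leq_sum => b1 Bb1; rewrite (bigD1 b1) //=; apply: leq_add; first exact: diag.
  by apply: leq_sum => b3 /andP[Bb3 ne]; apply: offdiag.
rewrite big_split /= sum_nat_const.
rewrite (eq_bigr (fun b1 => \sum_(b3 in B | b3 != b1) 2 * #|A| ^ 2 +
   \sum_(b3 in B | b3 != b1) \sum_(s in slopes b1 b3) slope_graph_size s)%N); last first.
  by move=> b1 _; rewrite big_split.
rewrite big_split /= addnA leq_add2r.
apply: (@leq_trans (#|B| * (#|A| ^ 3 + #|B| * #|A| ^ 2) + #|B| * (#|B| * (2 * #|A| ^ 2)))%N).
  rewrite leq_add2l -sum_nat_const; apply: leq_sum => b1 _.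
  by rewrite -sum_nat_const [leqRHS](bigID (fun b3 => b3 != b1)) /= leq_addr.
have : (#|B| * #|A| ^ 2 <= #|A| ^ 3)%N by rewrite expnS leq_mul2r leBA orbT.
move: (#|A| ^ 2)%N (#|A| ^ 3)%N #|B| => a2 a3 b h.
apply: (@leq_trans (b * (a3 + a3) + b * (a3 + a3))%N); last by lia.
by apply: leq_add; rewrite leq_mul2l; apply/orP; right; lia.
Qed.

End Triples.

(** * The bound on collinear triples *)

(** The parameters [y] and [z] are the two candidate savings. If the slopes in
    [S] were richer than the density [alpha = 8 * (1 + K) * (y + z)], each of
    the alternatives would contradict the equations defining [y] and [z], or
    the bound on the intersections with affine images of subfields. The
    factor [8 * (1 + K)], raised to the powers 191, 103 or 31, exceeds every
    constant of [rich_alternatives]. *)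
Lemma slopes_bound (R : realFieldType) (F : finFieldType) (A S : {set F}) (K n y z : R) :
  let N : R := #|A|%:R in
  let q : R := #|F|%:R in
  let alpha := 8%:R * (1 + K) * (y + z) in
  0 < K -> 1 <= n -> n <= N -> 0 < y -> 0 < z ->
  y ^+ 191 * n ^+ 2 = N -> z ^+ 103 * q = N ->
  (forall G : {set F}, proper_subfield G -> exists2 g : R, 0 < g & g ^+ 2 = #|G|%:R /\
     forall c d, #|A :&: affine_image c d G|%:R <= K * Num.max g (n * y ^+ 31)) ->
  0 \notin S -> #|S|%:R <= n ->
  (\sum_(s in S) slope_graph_size A s)%N%:R <= alpha * N ^+ 2 * n.
Proof.
move=> N q alpha K0 n1 nN y0 z0 yN zq hG S0 Sn.
have n0 : 0 < n by apply: lt_le_trans n1.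
have N0 : 0 < N by apply: lt_le_trans nN.
have A0 : A != set0 by rewrite -card_gt0 -(ltr0n R).
pose k := 8%:R * (1 + K).
have k8 : 8%:R <= k by rewrite /k; lra.
have k0 : 0 < k by apply: lt_le_trans k8.
have alpha0 : 0 < alpha by rewrite mulr_gt0 // addr_gt0.
rewrite leNgt; apply/negP => gt.
have rich : alpha * N ^+ 2 * n <=
    \sum_(s in S) \sum_(u in A) #|[set x in A | x - s * u \in dilate (1 - s) A]|%:R.
  apply: ltW; apply: lt_le_trans gt _; rewrite natr_sum; apply: ler_sum => s _.
  by rewrite natr_sum.
have alpha1 : alpha <= 1.
  rewrite leNgt; apply/negP => alpha_gt1.
  move: gt; rewrite ltNge => /negP[].
  apply: (@le_trans _ _ (\sum_(s in S) N ^+ 2)).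
    rewrite natr_sum; apply: ler_sum => s _; rewrite -natrX ler_nat.
    rewrite /slope_graph_size expnS expn1 -sum_nat_const; apply: leq_sum => u _.
    by apply/subset_leq_card/subsetP => x; rewrite inE => /andP[].
  rewrite sumr_const -[leLHS]mulr_natl mulrC.
  apply: ler_pM; rewrite ?sqr_ge0 ?ler0n //.
  by rewrite ler_peMl ?sqr_ge0 // ltW.
have apos i : 0 < alpha ^+ i by rewrite exprn_gt0.
have aW i j : (i <= j)%N -> alpha ^+ j <= alpha ^+ i.
  by move=> ij; rewrite ler_wiXn2l // ltW.
have ky : k * y <= alpha by rewrite /alpha ler_pM2l // lerDl ltW.
have kz : k * z <= alpha by rewrite /alpha ler_pM2l // lerDr ltW.
have a191 : k ^+ 191 * N <= alpha ^+ 191 * n ^+ 2.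
  rewrite -yN mulrA -exprMn ler_wpM2r ?sqr_ge0 // lerXn2r ?nnegrE //; last exact: ltW.
  by rewrite ltW // mulr_gt0.
have a103 : k ^+ 103 * N <= alpha ^+ 103 * q.
  rewrite -zq mulrA -exprMn ler_wpM2r ?ler0n // lerXn2r ?nnegrE //; last exact: ltW.
  by rewrite ltW // mulr_gt0.
have a191n : k ^+ 191 <= alpha ^+ 191 * n.
  rewrite -(ler_pM2r n0); have : 0 <= k ^+ 191 by rewrite exprn_ge0 // ltW.
  move: a191; move: (k ^+ 191) (alpha ^+ 191) => e f h e0.
  rewrite [leRHS](_ : _ = f * n ^+ 2); last by ring.
  by apply: le_trans h; rewrite ler_wpM2l.
have k2 i : 2%:R ^+ (3 * i) <= k ^+ i.
  rewrite exprM lerXn2r ?nnegrE ?exprn_ge0 ?ler0n ?(ltW k0) //.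
  by apply: le_trans k8; rewrite -natrX ler_nat.
have klarge i j : (j < 3 * i)%N -> 2%:R ^+ j < k ^+ i.
  by move=> ij; apply: lt_le_trans (k2 i); rewrite ltr_eXn2l // ltr1n.
case: (rich_alternatives alpha0 alpha1 n0 A0 S0 Sn rich).
- move=> h; have : k ^+ 191 * N <= 2%:R ^+ 453 * N.
    apply: le_trans a191 (le_trans _ h).
    by rewrite ler_wpM2r ?sqr_ge0 // aW.
  by rewrite ler_pM2r // leNgt klarge.
- move=> h; have : k ^+ 191 <= 2%:R ^+ 444.
    apply: le_trans a191n (le_trans _ h).
    by apply: ler_pM; rewrite ?aW // ltW.
  by rewrite leNgt klarge.
- move=> h; have : k ^+ 103 * N <= 2%:R ^+ 177 * N.
    apply: le_trans a103 (le_trans _ h).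
    by rewrite ler_wpM2r ?ler0n // aW.
  by rewrite ler_pM2r // leNgt klarge.
case=> G properG [nG hmu].
have [g g0 [gG hg]] := hG G properG.
have {hmu hg}[h18 h60] := hmu _ hg.
(* One factor of [k] pays for [K], the others for powers of two. *)
have kK i : K * 2%:R ^+ (3 * i + 3) <= k ^+ i.+1.
  rewrite exprSr exprD mulrCA; apply: ler_pM; rewrite ?exprn_ge0 ?ler0n ?mulr_ge0 ?(ltW K0) //.
  rewrite (_ : 2%:R ^+ 3 = 8%:R); last by rewrite -natrX.
  by rewrite /k; lra.
(* If the second bound dominates, compare the sizes of [C] and of the
   intersections; if the square root does, the subfield itself is bounded in
   terms of [alpha], which leaves no room for [n]. *)
have [ylarge|glarge] := leP g (n * y ^+ 31).
  move: h18; rewrite max_r // => h18.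
  have y31 : k ^+ 31 * y ^+ 31 <= alpha ^+ 18.
    rewrite -exprMn; apply: le_trans (aW 18 31 isT).
    by rewrite lerXn2r ?nnegrE ?(ltW alpha0) // ltW // mulr_gt0.
  have : k ^+ 31 * y ^+ 31 * n <= 2%:R ^+ 49 * (K * (n * y ^+ 31)).
    by apply: le_trans h18; rewrite ler_pM2r.
  rewrite [leRHS](_ : _ = K * 2%:R ^+ 49 * (y ^+ 31 * n)); last by ring.
  rewrite -mulrA ler_pM2r ?mulr_gt0 ?exprn_gt0 //.
  rewrite leNgt; apply/negP; rewrite negbK; apply: lt_le_trans (kK 30).
  by rewrite ltr_pM2l // ltr_eXn2l // ltr1n.
rewrite (max_l (ltW glarge)) -gG in h60.
have {}h60 : alpha ^+ 60 * g <= 2%:R ^+ 177 * K.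
  rewrite -(ler_pM2r g0); move: h60; rewrite expr2; move: (2%:R ^+ 177) (alpha ^+ 60) => e a.
  by rewrite !mulrA.
have h120 : alpha ^+ 120 * #|G|%:R <= (2%:R ^+ 177 * K) ^+ 2.
  have -> : alpha ^+ 120 * #|G|%:R = (alpha ^+ 60 * g) ^+ 2.
    by rewrite (exprMn 2 (alpha ^+ 60) g) gG -exprM.
  have lhs0 : 0 <= alpha ^+ 60 * g by rewrite ltW // (mulr_gt0 (apos 60%N)).
  have rhs0 : 0 <= 2%:R ^+ 177 * K by apply: le_trans lhs0 h60.
  by apply: lerXn2r.
have h123 : alpha ^+ 123 * n <= 2%:R ^+ 6 * (2%:R ^+ 177 * K) ^+ 2.
  apply: (@le_trans _ _ (alpha ^+ 120 * (2%:R ^+ 6 * #|G|%:R))).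
    by rewrite (exprD _ 120 3) -mulrA ler_pM2l.
  by rewrite mulrCA ler_pM2l // exprn_gt0.
have : k ^+ 191 <= (K * 2%:R ^+ 180) ^+ 2.
  apply: le_trans a191n (le_trans _ (le_trans h123 _)).
    by rewrite ler_pM2r // aW.
  rewrite le_eqVlt; apply/orP; left; apply/eqP.
  rewrite (exprD _ 177 3); move: (2%:R ^+ 177) => e; ring.
rewrite leNgt; apply/negP; rewrite negbK.
apply: lt_le_trans (_ : (k ^+ 95) ^+ 2 <= _); last first.
  by rewrite -exprM ler_weXn2l //; apply: le_trans k8; rewrite ler1n.
have kpos : 0 <= k ^+ 95 by rewrite exprn_ge0 // ltW.
have K180 : 0 <= K * 2%:R ^+ 180 by rewrite (mulr_ge0 (ltW K0)) // exprn_ge0.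
apply: ltrXn2r => //.
apply: lt_le_trans (kK 94).
by rewrite ltr_pM2l // ltr_eXn2l // ltr1n.
Qed.

(** Sum the bound on slopes over the pairs [(b1, b3)]. *)
Lemma T_le_savings (R : realFieldType) (F : finFieldType) (A B : {set F}) (K y z : R) :
  let N : R := #|A|%:R in
  let n : R := #|B|%:R in
  let q : R := #|F|%:R in
  0 < K -> (0 < #|B|)%N -> (#|B| <= #|A|)%N -> 0 < y -> 0 < z ->
  y ^+ 191 * n ^+ 2 = N -> z ^+ 103 * q = N ->
  (forall G : {set F}, proper_subfield G -> exists2 g : R, 0 < g & g ^+ 2 = #|G|%:R /\
     forall c d, #|A :&: affine_image c d G|%:R <= K * Num.max g (n * y ^+ 31)) ->
  (T A B)%:R <= 4%:R * N ^+ 3 * n + 8%:R * (1 + K) * (y + z) * N ^+ 2 * n ^+ 3.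
Proof.
move=> N n q K0 B0 BA y0 z0 yN zq hG.
have := T_le_slopes BA; rewrite -(ler_nat R) natrD => /le_trans; apply.
rewrite 2!natrM natrX lerD2l natr_sum.
set alpha := _ * (y + z).
have alpha0 : 0 <= alpha by rewrite mulr_ge0 ?ltW // ?mulr_gt0 ?addr_gt0 ?ltr0n.
apply: (@le_trans _ _ (\sum_(b1 in B) \sum_(b3 in B) (alpha * N ^+ 2 * n))); last first.
  rewrite !sumr_const -[leLHS]mulr_natl -[X in _ * X <= _]mulr_natl.
  by rewrite le_eqVlt; apply/orP; left; apply/eqP; rewrite -/n; ring.
apply: ler_sum => b1 Bb1; rewrite natr_sum big_mkcondr; apply: ler_sum => b3 Bb3.
case: ifP => [ne|_]; last by rewrite mulr_ge0 ?ler0n // mulr_ge0 // exprn_ge0 ?ler0n.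
have nz : b3 - b1 != 0 by rewrite subr_eq0.
apply: slopes_bound => //; rewrite ?ler1n ?ler_nat //.
  apply/imsetP => -[b]; rewrite !inE => /andP[_ /andP[neb _]] /esym/eqP.
  by rewrite mulf_eq0 invr_eq0 (negPf nz) orbF subr_eq0 (negPf neb).
apply: leq_trans (leq_imset_card _ _) _; apply: subset_leq_card.
by apply/subsetP => b; rewrite !inE => /and3P[].
Qed.

(** * Incidences and determined lines *)

Section Lines.
Variable F : finFieldType.
Implicit Types (p r t : F * F) (l : {set F * F}) (P : {set F * F}) (A B : {set F}).

Definition line_through p r : {set F * F} :=
  [set t | (r.1 - p.1) * (t.2 - p.2) == (t.1 - p.1) * (r.2 - p.2)].

Lemma line_throughP l p r :
  is_line l -> p \in l -> r \in l -> p != r -> l = line_through p r.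
Proof.
case/existsP=> a /existsP[b /existsP[c /andP[nab /eqP->]]].
case: p r => [p1 p2] [r1 r2]; rewrite !inE /= => /eqP hp /eqP hr npr.
apply/setP => -[t1 t2]; rewrite !inE /=.
have hu : a * (r1 - p1) + b * (r2 - p2) = 0.
  by rewrite (_ : _ + _ = a * r1 + b * r2 - (a * p1 + b * p2)); [rewrite hp hr subrr | ring].
have -> : (a * t1 + b * t2 == c) = (a * (t1 - p1) + b * (t2 - p2) == 0).
  by rewrite -subr_eq0 -hp; congr (_ == _); ring.
rewrite -[RHS]subr_eq0; move: hu npr.
rewrite xpair_eqE -(subr_eq0 p1) -(subr_eq0 p2) -(opprB r1) -(opprB r2) !oppr_eq0.
move: (r1 - p1) (r2 - p2) (t1 - p1) (t2 - p2) => u1 u2 v1 v2 hu nu.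
have [u10|nu1] := eqVneq u1 0.
  move: nu hu; rewrite u10 eqxx /= mulr0 add0r => nu2 /eqP.
  rewrite mulf_eq0 (negPf nu2) orbF => /eqP b0.
  move: nab; rewrite b0 xpair_eqE eqxx andbT => na.
  by rewrite !mul0r addr0 sub0r oppr_eq0 !mulf_eq0 (negPf na) (negPf nu2) orbF.
have ea : a = - (b * u2) / u1.
  by apply: (mulIf nu1); rewrite mulfVK // -(addrK (b * u2) (a * u1)) hu sub0r.
have nb : b != 0.
  by apply: contraNneq nab => b0; rewrite ea b0 mul0r oppr0 mul0r.
rewrite [X in X == _](_ : _ = b / u1 * (u1 * v2 - v1 * u2)); last by rewrite ea; field.
by rewrite mulf_eq0 mulf_eq0 invr_eq0 (negPf nb) (negPf nu1).
Qed.

Lemma line_through_is_line p r : p != r -> is_line (line_through p r).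
Proof.
case: p r => [p1 p2] [r1 r2] npr.
apply/existsP; exists (p2 - r2); apply/existsP; exists (r1 - p1).
apply/existsP; exists ((p2 - r2) * p1 + (r1 - p1) * p2); apply/andP; split.
  by apply: contraNneq npr => -[/subr0_eq -> /subr0_eq ->].
apply/eqP/setP => -[t1 t2]; rewrite !inE /= -subr_eq0 -[RHS]subr_eq0.
by congr (_ == _); ring.
Qed.

Lemma line_through_endpoints p r : p \in line_through p r /\ r \in line_through p r.
Proof. by rewrite !inE !subrr mulr0 mul0r eqxx. Qed.

Definition points_on P l := P :&: l.

Lemma incidencesE P (L : {set {set F * F}}) :
  incidences P L = (\sum_(l in L) #|points_on P l|)%N.
Proof.
rewrite /incidences -sum1_card.
rewrite (eq_bigr (fun l => \sum_(p | (p \in P) && (p \in l)) 1)%N); last first.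
  by move=> l _; rewrite sum1_card; apply: eq_card => p; rewrite !inE.
rewrite (exchange_big_dep predT) //= pair_big_dep /=.
by apply: eq_bigl => -[p l]; rewrite !inE /= andbCA.
Qed.

Lemma card_distinct_pairs (I : finType) (D : {set I}) :
  #|[set p : I * I | [&& p.1 \in D, p.2 \in D & p.1 != p.2]]| = (#|D| * #|D|.-1)%N.
Proof.
rewrite -sum1_card -sum_nat_const.
rewrite (eq_bigr (fun x => \sum_(y | (y \in D) && (x != y)) 1)%N); last first.
  move=> x Dx; rewrite sum1_card (cardsD1 x D) Dx add1n /=; apply: eq_card => y.
  by rewrite !inE unfold_in /= eq_sym andbC.
rewrite pair_big_dep /=; apply: eq_bigl => -[x y]; by rewrite inE /=.
Qed.

(** Two distinct points determine the line that carries the triple, so the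
    ordered triples on different lines that start with two distinct points
    are different elements of the set counted by [T]. *)
Lemma rich_lines_le_T A B (L : {set {set F * F}}) :
  (forall l, l \in L -> is_line l) ->
  (\sum_(l in L) #|points_on (setX A B) l| ^ 2 * #|points_on (setX A B) l|.-1 <= T A B)%N.
Proof.
move=> lineL; rewrite /T; set X := [set t | _].
pose g (t : (F * F * F) * (F * F * F)) :=
  line_through (t.1.1.1, t.2.1.1) (t.1.1.2, t.2.1.2).
apply: leq_trans (sum_card_fibers_le L X g); apply: leq_sum => l Ll.
set D := points_on _ l.
pose E := setX [set p : (F * F) * (F * F) | [&& p.1 \in D, p.2 \in D & p.1 != p.2]] D.
have -> : (#|D| ^ 2 * #|D|.-1)%N = #|E|.
  by rewrite cardsX card_distinct_pairs mulnAC -mulnn.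
pose f (t : (F * F) * (F * F) * (F * F)) :=
  ((t.1.1.1, t.1.2.1, t.2.1), (t.1.1.2, t.1.2.2, t.2.2)).
have finj : injective f.
  by move=> [[[? ?] [? ?]] [? ?]] [[[? ?] [? ?]] [? ?]] [-> -> -> -> -> ->].
rewrite -(card_imset _ finj); apply/subset_leq_card/subsetP => _ /imsetP[t Et ->].
case: t Et => [[p r] t] /setXP[/=]; rewrite inE /= => /and3P[Dp Dr npr] Dt.
have inD x : x \in D -> [/\ x.1 \in A, x.2 \in B & x \in l].
  by rewrite !inE => /andP[/andP[-> ->] ->].
have [Ap Bp lp] := inD _ Dp; have [Ar Br lr] := inD _ Dr; have [At Bt lt] := inD _ Dt.
have lE := line_throughP (lineL _ Ll) lp lr npr.
rewrite inE /g /= -!surjective_pairing -lE eqxx andbT inE /= Ap Ar At Bp Br Bt /=.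
by move: lt; rewrite lE inE.
Qed.

Lemma determined_lines_is_line P l : l \in determined_lines P -> is_line l.
Proof. by rewrite inE => /andP[]. Qed.

Lemma determined_lines_card P l : l \in determined_lines P -> (1 < #|points_on P l|)%N.
Proof.
rewrite inE => /andP[_ /exists_inP[p Pp /exists_inP[r Pr /and3P[npr lp lr]]]].
apply: leq_trans (_ : #|[set p; r]| <= _)%N; first by rewrite cards2 npr.
by apply/subset_leq_card/subsetP => t; rewrite !inE => /orP[]/eqP->; rewrite ?Pp ?Pr.
Qed.

Lemma pairs_le_determined_lines P :
  (#|P| * #|P|.-1 <= \sum_(l in determined_lines P) #|points_on P l| ^ 2)%N.
Proof.
rewrite -card_distinct_pairs -sum1_card.
rewrite (eq_bigr (fun l => \sum_(p : (F * F) * (F * F) |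
   (p.1 \in points_on P l) && (p.2 \in points_on P l)) 1)%N); last first.
  move=> l _; rewrite -mulnn -cardsX -sum1_card; apply: eq_bigl => p.
  by rewrite !inE.
rewrite (exchange_big_dep predT) //= big_mkcond /=; apply: leq_sum => -[p r] _.
rewrite inE /=; case: ifP => // /and3P[Pp Pr npr].
have [lp lr] := line_through_endpoints p r.
have inL : line_through p r \in determined_lines P.
  rewrite inE line_through_is_line //.
  by apply/exists_inP; exists p => //; apply/exists_inP; exists r => //; rewrite npr lp.
have onl t : t \in P -> t \in line_through p r -> t \in points_on P (line_through p r).
  by move=> Pt lt; rewrite in_setI Pt.
by rewrite (bigD1 (line_through p r)) //= inL !onl.
Qed.

End Lines.

Section PowerSums.
Variables (R : realFieldType) (I : finType) (D : {set I}) (f : I -> R).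
Hypothesis f0 : forall i, i \in D -> 0 <= f i.

Let square_sum_sq :
  (\sum_(i in D) f i ^+ 2) ^+ 2 <= (\sum_(i in D) f i) * \sum_(i in D) f i ^+ 3.
Proof.
have := weighted_cauchy_schwarz f f0.
under eq_bigr do rewrite -expr2.
by under [X in _ <= _ * X -> _]eq_bigr do rewrite -exprS.
Qed.

(** Hoelder's inequality with exponents 3 and 3/2, in integral powers. *)
Lemma sum_cube_le : (\sum_(i in D) f i) ^+ 3 <= #|D|%:R ^+ 2 * \sum_(i in D) f i ^+ 3.
Proof.
have S10 : 0 <= \sum_(i in D) f i by apply: sumr_ge0.
have S30 : 0 <= \sum_(i in D) f i ^+ 3 by apply: sumr_ge0 => i /f0 ?; apply: exprn_ge0.
have cs := cauchy_schwarz_card D f; have sq := square_sum_sq.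
have [->|nz] := eqVneq (\sum_(i in D) f i) 0.
  by rewrite expr0n /= mulr_ge0 // sqr_ge0.
have S1 : 0 < \sum_(i in D) f i by rewrite lt_def nz.
rewrite -(ler_pM2l S1) -exprS (exprM _ 2 2).
apply: le_trans (_ : (#|D|%:R * \sum_(i in D) f i ^+ 2) ^+ 2 <= _).
  by apply: lerXn2r; rewrite ?nnegrE ?sqr_ge0 // (le_trans (sqr_ge0 _) cs).
by rewrite [leLHS]exprMn [leRHS]mulrCA ler_wpM2l ?sqr_ge0.
Qed.

(** Hoelder's inequality with exponents 3/2 and 3, in integral powers. *)
Lemma sum_square_le :
  (\sum_(i in D) f i ^+ 2) ^+ 3 <= #|D|%:R * (\sum_(i in D) f i ^+ 3) ^+ 2.
Proof.
have S20 : 0 <= \sum_(i in D) f i ^+ 2 by apply: sumr_ge0 => i _; apply: sqr_ge0.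
have cs := cauchy_schwarz_card D f; have sq := square_sum_sq.
have [->|nz] := eqVneq (\sum_(i in D) f i ^+ 2) 0.
  by rewrite expr0n /= mulr_ge0 // sqr_ge0.
have S2 : 0 < \sum_(i in D) f i ^+ 2 by rewrite lt_def nz.
rewrite -(ler_pM2l S2) -exprS (exprM _ 2 2).
apply: le_trans (_ : ((\sum_(i in D) f i) * \sum_(i in D) f i ^+ 3) ^+ 2 <= _).
  by apply: lerXn2r; rewrite ?nnegrE ?sqr_ge0 // (le_trans (sqr_ge0 _) sq).
by rewrite [leLHS]exprMn [leRHS]mulrA ler_wpM2r ?sqr_ge0 // [leRHS]mulrC.
Qed.

End PowerSums.

Section Consequences.
Variables (R : realFieldType) (F : finFieldType) (A B : {set F}).
Let i (l : {set F * F}) : R := #|points_on (setX A B) l|%:R.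

(* When [i l >= 2], the triples on [l] that start with two distinct points
   make up at least half of all triples on [l]. *)
Let cubes_le_T (L : {set {set F * F}}) : (forall l, l \in L -> is_line l) ->
  (forall l, l \in L -> 1 < #|points_on (setX A B) l|)%N ->
  \sum_(l in L) i l ^+ 3 <= 2%:R * (T A B)%:R.
Proof.
move=> lineL richL; rewrite -natrM.
under eq_bigr do rewrite -natrX.
rewrite -natr_sum ler_nat.
apply: leq_trans (_ : 2 * _ <= _)%N; last first.
  by rewrite leq_mul2l; apply/orP; right; apply: rich_lines_le_T lineL.
rewrite big_distrr /=; apply: leq_sum => l /richL.
case: #|_| => [|[|k]] // _; rewrite expnS [(2 * _)%N]mulnCA mulnC leq_mul2l.
by apply/orP; right => /=; lia.
Qed.

(** Lines with at most one point account for the term [#|L|]; the others for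
    [x], by Hoelder's inequality. *)
Lemma incidences_le (L : {set {set F * F}}) : (forall l, l \in L -> is_line l) ->
  exists2 x : R, 0 <= x /\ x ^+ 3 <= 2%:R * (T A B)%:R * #|L|%:R ^+ 2 &
    (incidences (setX A B) L)%:R <= #|L|%:R + x.
Proof.
move=> lineL; pose L2 := [set l in L | (1 < #|points_on (setX A B) l|)%N].
have i0 l : l \in L2 -> 0 <= i l by rewrite /i ler0n.
exists (\sum_(l in L2) i l); first split.
- exact: sumr_ge0.
- apply: le_trans (sum_cube_le i0) _; rewrite mulrC.
  apply: ler_pM; rewrite ?sqr_ge0 //.
  + by apply: sumr_ge0 => l _; rewrite exprn_ge0 ?ler0n.
  + by apply: cubes_le_T => l; rewrite inE => /andP[] // /lineL.
  + apply: lerXn2r; rewrite ?nnegrE ?ler0n // ler_nat subset_leq_card //.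
    by apply/subsetP => l; rewrite inE => /andP[].
rewrite incidencesE natr_sum (bigID (mem L2)) /= addrC lerD //.
  rewrite -sum1_card natr_sum big_mkcondr; apply: ler_sum => l Ll.
  rewrite inE Ll /= -leqNgt; case: ifP => [|_]; last exact: ler01.
  by rewrite -(ler_nat R).
rewrite le_eqVlt; apply/orP; left; apply/eqP; apply: eq_bigl => l.
by rewrite !inE; case: (l \in L).
Qed.

(** The determined lines cover all pairs of distinct points, so the sum of
    the [i l ^ 2] over them is at least half of the square of the number of
    points; Hoelder's inequality compares it with the sum of cubes. *)
Lemma determined_lines_ge : (1 < #|A| * #|B|)%N ->
  (#|A|%:R * #|B|%:R) ^+ 6 <= 32%:R * (T A B)%:R ^+ 2 * #|determined_lines (setX A B)|%:R :> R.
Proof.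
set L := determined_lines _ => M1.
have i0 l : l \in L -> 0 <= i l by rewrite /i ler0n.
set M : R := _ * _.
have pairs : M ^+ 2 / 2%:R <= \sum_(l in L) i l ^+ 2.
  apply: le_trans (_ : (#|setX A B| * #|setX A B|.-1)%N%:R <= _); last first.
    apply: le_trans (_ : (\sum_(l in L) #|points_on (setX A B) l| ^ 2)%N%:R <= _).
      by rewrite ler_nat pairs_le_determined_lines.
    by rewrite natr_sum; apply: ler_sum => l _; rewrite natrX.
  rewrite cardsX ler_pdivrMr // /M -natrM -natrX -natrM ler_nat.
  by move: (#|A| * #|B|)%N M1 => [|[|k]] //= _; rewrite -mulnA leq_mul2l; apply/orP; right; lia.
have cubes : \sum_(l in L) i l ^+ 3 <= 2%:R * (T A B)%:R.
  by apply: cubes_le_T => l; [apply: determined_lines_is_line | apply: determined_lines_card].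
have := sum_square_le i0; set S2 := \sum_(l in L) _; set S3 := \sum_(l in L) _ => h.
have M20 : 0 <= M ^+ 2 / 2%:R by rewrite divr_ge0 ?sqr_ge0.
have S30 : 0 <= S3 by apply: sumr_ge0 => l _; rewrite exprn_ge0 ?ler0n.
have : (M ^+ 2 / 2%:R) ^+ 3 <= #|L|%:R * (2%:R * (T A B)%:R) ^+ 2.
  apply: le_trans (_ : S2 ^+ 3 <= _).
    by apply: lerXn2r; rewrite ?nnegrE // (le_trans M20).
  apply: le_trans h _; rewrite ler_wpM2l ?ler0n //.
  by apply: lerXn2r; rewrite ?nnegrE // (le_trans S30).
rewrite expr_div_n -exprM; move: (M ^+ 6) => M6.
by move: (#|L|%:R : R) => a; nra.
Qed.

End Consequences.

(** * The main estimates *)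

Lemma powR_expn (R : realType) (a x : R) k : (a `^ x) ^+ k = a `^ (x * k%:R).
Proof. by rewrite -powR_mulrn ?powR_ge0 // powRrM. Qed.

Lemma powR_root (R : realType) (a : R) d : 0 <= a -> (0 < d)%N -> (a `^ (1 / d%:R)) ^+ d = a.
Proof.
by move=> a0 d0; rewrite powR_expn divfK ?pnatr_eq0 -?lt0n // powRr1.
Qed.

Lemma powR_frac (R : realType) (a : R) k d : a `^ (k%:R / d%:R) = (a `^ (1 / d%:R)) ^+ k.
Proof. by rewrite powR_expn mulrAC mul1r. Qed.

Lemma sum_cubes_le (R : realFieldType) (x y z : R) : 0 <= x -> 0 <= y -> 0 <= z ->
  x ^+ 3 + y ^+ 3 + z ^+ 3 <= (x + y + z) ^+ 3.
Proof.
move=> x0 y0 z0; rewrite -subr_ge0.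
rewrite (_ : _ - _ = 3%:R * ((x + y) * (y + z) * (z + x))); last by ring.
by rewrite mulr_ge0 ?ler0n // !mulr_ge0 ?addr_ge0.
Qed.

Lemma sqr_sum3_le (R : realFieldType) (x y z : R) :
  (x + y + z) ^+ 2 <= 3%:R * (x ^+ 2 + y ^+ 2 + z ^+ 2).
Proof.
rewrite -subr_ge0.
rewrite (_ : _ - _ = (x - y) ^+ 2 + (y - z) ^+ 2 + (z - x) ^+ 2); last by ring.
by rewrite !addr_ge0 ?sqr_ge0.
Qed.

Theorem theorem1 (R : realType) (K : R) (hK : 0 < K) :
  exists C1 C2 C3 : R, [/\ 0 < C1, 0 < C2, 0 < C3 &
    forall (F : finFieldType) (A B : {set F}) (L : {set {set F * F}}),
    let q : R := #|F|%:R in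
    let a : R := #|A|%:R in
    let b : R := #|B|%:R in
    let m : R := #|L|%:R in
    0 \notin A -> 0 \notin B ->
    (2 <= #|B|)%N -> (#|B| <= #|A|)%N ->
    (forall l : {set F * F}, l \in L -> is_line l) ->
    (forall (G : {set F}) (c d : F), proper_subfield G ->
       #|A :&: affine_image c d G|%:R
         <= K * Num.max (#|G|%:R `^ (1 / 2)) (a `^ (31 / 191) * b `^ (129 / 191))) ->
    [/\ (T A B)%:R
          <= C1 * (a `^ (383 / 191) * b `^ (571 / 191)
                   + q `^ (- (1 / 103)) * a `^ (207 / 103) * b ^+ 3
                   + a ^+ 3 * b),
        (incidences (setX A B) L)%:R
          <= C2 * ((a `^ (383 / 573) * b `^ (571 / 573)
                    + q `^ (- (1 / 309)) * a `^ (207 / 309) * b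
                    + a * b `^ (1 / 3)) * m `^ (2 / 3)
                   + m)
      & Num.min (a `^ (380 / 191) * b `^ (4 / 191))
                (Num.min (q `^ (2 / 103) * a `^ (204 / 103)) (b ^+ 4))
          <= C3 * #|determined_lines (setX A B)|%:R]].
Proof.
pose C := 8%:R * (1 + K).
have C8 : 8%:R <= C by rewrite /C; lra.
have C21 : 1 <= 2%:R * C by lra.
have C0 : 0 < C by apply: lt_le_trans C8.
exists C, (2%:R * C), (288%:R * C ^+ 2); split=> //.
- exact: mulr_gt0.
- by apply: mulr_gt0 => //; apply: exprn_gt0.
move=> F A B L q a b m _ _ B2 BA lineL hG.
have b0 : 0 < b by rewrite ltr0n (leq_trans _ B2).
have a0 : 0 < a by rewrite ltr0n (leq_trans _ BA) // (leq_trans _ B2).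
have q0 : 0 < q by rewrite ltr0n; apply/card_gt0P; exists 0.
(* The three terms of the bound on [T]. *)
pose s1 := a `^ (383 / 191) * b `^ (571 / 191).
pose s2 := q `^ (- (1 / 103)) * a `^ (207 / 103) * b ^+ 3.
pose s3 := a ^+ 3 * b.
have s10 : 0 < s1 by rewrite mulr_gt0 ?powR_gt0.
have s20 : 0 < s2 by rewrite !mulr_gt0 ?powR_gt0 ?exprn_gt0.
have s30 : 0 < s3 by rewrite mulr_gt0 ?exprn_gt0.
(* Rational powers become natural powers of these roots; the two savings are
   then [u / v ^+ 2] and [w / t]. *)
pose u := a `^ (1 / 191); pose v := b `^ (1 / 191).
pose w := a `^ (1 / 103); pose t := q `^ (1 / 103).
have ua : u ^+ 191 = a by apply: powR_root; rewrite ?ltW.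
have vb : v ^+ 191 = b by apply: powR_root; rewrite ?ltW.
have wa : w ^+ 103 = a by apply: powR_root; rewrite ?ltW.
have tq : t ^+ 103 = q by apply: powR_root; rewrite ?ltW.
have u0 : 0 < u by rewrite powR_gt0.
have v0 : 0 < v by rewrite powR_gt0.
have w0 : 0 < w by rewrite powR_gt0.
have t0 : 0 < t by rewrite powR_gt0.
have s1E : s1 = u / v ^+ 2 * a ^+ 2 * b ^+ 3.
  rewrite /s1 (powR_frac a 383) (powR_frac b 571) -/u -/v -[in RHS]ua -[in RHS]vb -!exprM.
  rewrite (exprD u 1 382) (exprD v 2 571) expr1; field; by rewrite gt_eqF.
have s2E : s2 = w / t * a ^+ 2 * b ^+ 3.
  rewrite /s2 powRN (powR_frac a 207) -/w -/t -[in RHS]wa -!exprM.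
  rewrite (exprD w 1 206) expr1; field; by rewrite gt_eqF.
have T_le : (T A B)%:R <= C * (s1 + s2 + s3).
  apply: (@le_trans _ _ (4%:R * a ^+ 3 * b + C * (u / v ^+ 2 + w / t) * a ^+ 2 * b ^+ 3)).
    apply: T_le_savings; rewrite ?divr_gt0 ?exprn_gt0 //.
    - exact: leq_trans B2.
    - rewrite expr_div_n -/b -/a ua -vb -!exprM mulfVK //.
      by rewrite gt_eqF ?exprn_gt0.
    - rewrite expr_div_n -/a wa tq mulfVK // gt_eqF //.
    move=> G properG; exists (#|G|%:R `^ (1 / 2)).
      case: properG => -[G1 _ _] _; rewrite powR_gt0 // ltr0n; apply/card_gt0P.
      by exists 1.
    split; first exact: powR_root.
    move=> c d; apply: le_trans (hG G c d properG) _.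
    rewrite (powR_frac a 31) (powR_frac b 129) -/u -/v -/b -[in leRHS]vb.
    rewrite (_ : v ^+ 191 * _ = u ^+ 31 * v ^+ 129) //.
    rewrite expr_div_n -exprM (exprD v 129 62); field; by rewrite gt_eqF.
  have -> : C * (u / v ^+ 2 + w / t) * a ^+ 2 * b ^+ 3 = C * (s1 + s2).
    by rewrite s1E s2E; ring.
  rewrite addrC [leRHS]mulrDr lerD2l -mulrA ler_pM2r //; apply: le_trans C8.
  by rewrite ler_nat.
split; first exact: T_le.
- have [x [x0 x3] hx] := incidences_le R A B lineL.
  apply: le_trans hx _; rewrite -/m.
  (* The coefficients of [m `^ (2 / 3)] are the cube roots of [s1], [s2], [s3]. *)
  set t1 := a `^ _ * _; set t2 := _ * b; set t3 := a * _.
  have t10 : 0 <= t1 by rewrite mulr_ge0 ?powR_ge0.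
  have t20 : 0 <= t2 by rewrite !mulr_ge0 ?powR_ge0 // ltW.
  have t30 : 0 <= t3 by rewrite mulr_ge0 ?powR_ge0 // ltW.
  have t1E : t1 ^+ 3 = s1.
    by rewrite exprMn !powR_expn; congr (a `^ _ * b `^ _); field.
  have t2E : t2 ^+ 3 = s2.
    by rewrite !exprMn !powR_expn; congr (q `^ _ * a `^ _ * _); field.
  have t3E : t3 ^+ 3 = s3.
    by rewrite exprMn powR_root // ltW.
  pose M := m `^ (2 / 3).
  have M0 : 0 <= M by rewrite powR_ge0.
  have M3 : M ^+ 3 = m ^+ 2.
    by rewrite powR_expn -powR_mulrn ?ler0n //; congr (_ `^ _); field.
  suff : x <= 2%:R * C * ((t1 + t2 + t3) * M).
    by move=> hx; rewrite addrC mulrDr lerD // ler_peMl ?ler0n.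
  rewrite -(@ler_pXn2r _ 3) ?nnegrE //; last first.
    by rewrite mulr_ge0 ?mulr_ge0 ?addr_ge0 // ltW.
  apply: le_trans x3 _; rewrite (exprMn 3 (2%:R * C)) (exprMn 3 _ M) M3 mulrA -/m.
  rewrite ler_wpM2r ?sqr_ge0 //.
  have cubes : s1 + s2 + s3 <= (t1 + t2 + t3) ^+ 3.
    by rewrite -t1E -t2E -t3E sum_cubes_le.
  have S0 : 0 <= s1 + s2 + s3 by rewrite !addr_ge0 ?ltW.
  apply: le_trans (_ : 2%:R * C * (s1 + s2 + s3) <= _).
    by rewrite -mulrA ler_wpM2l.
  apply: ler_pM => //; first by rewrite mulr_ge0 // ltW.
  by rewrite exprS ler_peMr ?exprn_ege1 // (le_trans ler01).
set mu := Num.min _ _.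
pose S := s1 + s2 + s3.
have S0 : 0 < S by rewrite !addr_gt0.
have mu0 : 0 <= mu by rewrite !le_min ?mulr_ge0 ?powR_ge0 ?exprn_ge0 // ltW.
(* Each argument of the minimum is [(a * b) ^+ 6] over the square of a term. *)
have mu1 : mu * s1 ^+ 2 <= (a * b) ^+ 6.
  apply: (@le_trans _ _ (a `^ (380 / 191) * b `^ (4 / 191) * s1 ^+ 2)).
    by rewrite ler_wpM2r ?sqr_ge0 // ge_min lexx.
  have -> : a `^ (380 / 191) * b `^ (4 / 191) = a ^+ 2 / (u / v ^+ 2) ^+ 2.
    rewrite (powR_frac a 380) (powR_frac b 4) -/u -/v -[in RHS]ua -exprM (exprD u 380 2).
    by field; rewrite !gt_eqF.
  by rewrite s1E le_eqVlt; apply/orP; left; apply/eqP; field; rewrite !gt_eqF.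
have mu2 : mu * s2 ^+ 2 <= (a * b) ^+ 6.
  apply: (@le_trans _ _ (q `^ (2 / 103) * a `^ (204 / 103) * s2 ^+ 2)).
    by rewrite ler_wpM2r ?sqr_ge0 // !ge_min lexx orbT.
  have -> : q `^ (2 / 103) * a `^ (204 / 103) = a ^+ 2 / (w / t) ^+ 2.
    rewrite (powR_frac q 2) (powR_frac a 204) -/w -/t -[in RHS]wa -exprM (exprD w 204 2).
    by field; rewrite !gt_eqF.
  by rewrite s2E le_eqVlt; apply/orP; left; apply/eqP; field; rewrite !gt_eqF.
have mu3 : mu * s3 ^+ 2 <= (a * b) ^+ 6.
  apply: (@le_trans _ _ (b ^+ 4 * s3 ^+ 2)).
    by rewrite ler_wpM2r ?sqr_ge0 // !ge_min lexx !orbT.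
  by rewrite /s3 le_eqVlt; apply/orP; left; apply/eqP; ring.
have AB1 : (1 < #|A| * #|B|)%N.
  by rewrite (leq_trans B2) // leq_pmull // (leq_trans _ BA) // (leq_trans _ B2).
have := determined_lines_ge R AB1; rewrite -/a -/b.
set Lam : R := #|_|%:R => hLam.
have T2 : (T A B)%:R ^+ 2 <= C ^+ 2 * S ^+ 2 :> R.
  by rewrite -exprMn; apply: lerXn2r; rewrite ?nnegrE ?ler0n // mulr_ge0 ?ltW.
have Lam0 : 0 <= Lam by rewrite ler0n.
have S2 : 0 < S ^+ 2 by rewrite exprn_gt0.
rewrite -(ler_pM2r S2).
apply: (@le_trans _ _ (3%:R * (mu * s1 ^+ 2 + mu * s2 ^+ 2 + mu * s3 ^+ 2))).
  have : S ^+ 2 <= 3%:R * (s1 ^+ 2 + s2 ^+ 2 + s3 ^+ 2) by apply: sqr_sum3_le.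
  by move=> /(ler_wpM2l mu0); move: (S ^+ 2) => S'; lra.
have T2L : (T A B)%:R ^+ 2 * Lam <= C ^+ 2 * S ^+ 2 * Lam by rewrite ler_wpM2r.
move: mu1 mu2 mu3 hLam T2L; move: (_ * s1 ^+ 2) (_ * s2 ^+ 2) (_ * s3 ^+ 2) => x1 x2 x3.
move: ((a * b) ^+ 6) ((T A B)%:R ^+ 2) (C ^+ 2) (S ^+ 2) => P T' C' S'; lra.
Qed.
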